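(* Suppose there is a constant $\varepsilon\in(0,1]$ such that $\gamma_1:=\mathbb E|\xi|^{1+\varepsilon}<\infty$. Let $\mathbf M_0:={\rm SVD}_r\big(n^{-1}\sum_{i=1}^n\mathbf X_iY_i\big)$. For any small $c_0>0$ there exist constants $C,c_1,c_2,c_3>0$ depending only on $c_0$ such that if $$n>C\max\Big\{\kappa^2d_1r^2\log d_1,\ (d_1r)^{\frac{1+\varepsilon}{2\varepsilon}}\sigma_r^{-\frac{1+\varepsilon}{\varepsilon}}(\gamma_1\log d_1)^{\frac1\varepsilon}\Big\},$$ then with probability over $1-c_1d_1^{-1}-c_2(\log d_1)^{-1}-c_3e^{-d_1}$ one has $\|\mathbf M_0-\mathbf M^*\|_{\rm F}\le c_0\sigma_r$, where $\kappa=\sigma_1(\mathbf M^* )\sigma_r^{-1}(\mathbf M^* )$ is the condition number of $\mathbf M^*$.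
   Context: Model: $d_1\ge d_2$; $\mathbf M^*\in\mathbb R^{d_1\times d_2}$ has rank $r$; $\sigma_j(\mathbf M^* )$ is its $j$-th largest singular value and $\sigma_r=\sigma_r(\mathbf M^* )$; $(\mathbf X_i,Y_i)_{i=1}^n$ are i.i.d. with $Y_i=\langle\mathbf X_i,\mathbf M^*\rangle+\xi_i$, $\langle\mathbf A,\mathbf B\rangle={\rm tr}(\mathbf A^\top\mathbf B)$, where $\mathbf X_i$ has i.i.d. $N(0,1)$ entries and is independent of the i.i.d. mean-zero noise $\xi_i$, distributed as $\xi$. ${\rm SVD}_r(\cdot)$ is the best rank-$r$ approximation by truncated SVD; $\|\cdot\|_{\rm F}$ is the Frobenius norm. *)

(* Defs.v *)
From HB Require Import structures.
From mathcomp Require Import all_boot all_order all_algebra.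
From mathcomp Require Import all_classical all_reals all_analysis.
From mathcomp Require Import ring lra.

Set Implicit Arguments.
Unset Strict Implicit.
Unset Printing Implicit Defensive.

Import Order.TTheory GRing.Theory Num.Theory.
Import numFieldNormedType.Exports.

Local Open Scope classical_set_scope.
Local Open Scope ring_scope.

Definition mxinner (R : realType) (m n : nat) (A B : 'M[R]_(m, n)) : R :=
  \tr (A^T *m B).

Definition frobenius (R : realType) (m n : nat) (A : 'M[R]_(m, n)) : R :=
  Num.sqrt (mxinner A A).

Definition rect_diag (R : realType) (m n : nat) (s : nat -> R) : 'M[R]_(m, n) :=
  \matrix_(i < m, j < n) (s i *+ (i == j :> nat)).

(* The singular values are s 0 >= s 1 >= ... (0-based); the factors U and V   *)
(* are square, and s is padded with zeros past the smaller dimension.         *)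
Definition is_svd (R : realType) (m n : nat) (A : 'M[R]_(m, n))
    (U : 'M[R]_m) (s : nat -> R) (V : 'M[R]_n) : Prop :=
  [/\ U^T *m U = 1%:M, V^T *m V = 1%:M,
      [/\ forall k, 0 <= s k,
          forall k l, (k <= l)%N -> s l <= s k &
          forall k, (minn m n <= k)%N -> s k = 0] &
      A = U *m rect_diag m n s *m V^T].

Section svd_existence.
Variable R : realType.

Let nsq n (x : 'rV[R]_n) : R := (x *m x^T) 0 0.

Let nsqE n (x : 'rV[R]_n) : nsq x = \sum_j x 0 j ^+ 2.
Proof. by rewrite /nsq mxE; apply: eq_bigr => j _; rewrite mxE expr2. Qed.

Let nsq_ge0 n (x : 'rV[R]_n) : 0 <= nsq x.
Proof. by rewrite nsqE sumr_ge0// => j _; rewrite sqr_ge0. Qed.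

Let nsq_eq0 n (x : 'rV[R]_n) : nsq x = 0 -> x = 0.
Proof.
rewrite nsqE => /eqP; rewrite psumr_eq0; last by move=> j _; exact: sqr_ge0.
move=> /allP h; apply/rowP => j; rewrite mxE.
by have := h j (mem_index_enum _); rewrite sqrf_eq0 => /eqP.
Qed.

Let nsqZ n a (x : 'rV[R]_n) : nsq (a *: x) = a ^+ 2 * nsq x.
Proof. by rewrite /nsq linearZ/= -scalemxAl -scalemxAr scalerA mxE expr2. Qed.

Let nsqM n (x : 'rV[R]_n) p (Q : 'M[R]_(n, p)) :
  Q *m Q^T = 1%:M -> nsq (x *m Q) = nsq x.
Proof. by move=> h; rewrite /nsq trmx_mul mulmxA -(mulmxA x) h mulmx1. Qed.

Let nsqD n (x y : 'rV[R]_n) t :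
  nsq (x + t *: y) = nsq x + 2 * t * (x *m y^T) 0 0 + t ^+ 2 * nsq y.
Proof.
rewrite /nsq linearD linearZ/= mulmxDl !mulmxDr -!scalemxAl -!scalemxAr.
have -> : y *m x^T = x *m y^T.
  by apply/matrixP => i j; rewrite !ord1 !mxE; apply: eq_bigr => k _;
    rewrite !mxE mulrC.
by rewrite !mxE; ring.
Qed.

Let continuous_nsq m n (A : 'M[R]_(m, n)) :
  continuous (fun x : 'rV[R]_m => nsq (x *m A)).
Proof.
move=> x; under eq_fun do rewrite nsqE.
apply: continuous_big => [|j _ {}x]; first exact: add_continuous.
have h : continuous (fun y : 'rV[R]_m => (y *m A) 0 j).
  under eq_fun do rewrite mxE.
  apply: continuous_big => [|k _ y]; first exact: add_continuous.
  exact: (cvgM (@coord_continuous R 1 m 0 k y) (cvg_cst (A k j))).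
by under eq_fun do rewrite expr2; exact: (cvgM (h x) (h x)).
Qed.

Let max_exists m n (A : 'M[R]_(m.+1, n)) : exists2 x : 'rV[R]_m.+1,
  nsq x = 1 & forall z, nsq (z *m A) <= nsq (x *m A) * nsq z.
Proof.
pose S := [set x : 'rV[R]_m.+1 | nsq x = 1].
have cS : compact S.
  apply: bounded_closed_compact.
    exists 1; split; first exact: num_real.
    move=> y y1 x Sx /=; apply: le_trans (ltW y1).
    rewrite /Num.norm/= mx_normrE.
    apply: bigmax_le => // -[i j] _ /=.
    rewrite -(@ler_pXn2r _ 2)// ?nnegrE// expr1n real_normK ?num_real//.
    rewrite -Sx nsqE (bigD1 j)//= ord1 lerDl sumr_ge0// => k _.
    exact: sqr_ge0.
  have -> : S = (fun x : 'rV[R]_m.+1 => nsq (x *m 1%:M)) @^-1` [set 1].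
    by apply/seteqP; split => x /=; rewrite /S/= mulmx1.
  apply: preimage_closed; last exact: closed_eq.
  by move=> x _; exact: continuous_nsq.
have S0 : S !=set0.
  exists (delta_mx 0 0); rewrite /S/= nsqE (bigD1 0)//= big1; last first.
    by move=> i i0; rewrite mxE (negbTE i0) andbF expr0n.
  by rewrite mxE !eqxx expr1n addr0.
have [x Sx xmax] := @EVT_max_rV R m.+1 (fun x => nsq (x *m A)) S S0 cS
  (continuous_subspaceT (@continuous_nsq _ _ A)).
exists x => [|z]; first by move: Sx; rewrite inE.
have [z0|z0] := eqVneq (nsq z) 0.
  by rewrite (nsq_eq0 z0) mul0mx /nsq !mul0mx mxE mulr0.
have zp : 0 < nsq z by rewrite lt_def z0 nsq_ge0.
have := xmax ((Num.sqrt (nsq z))^-1 *: z).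
rewrite inE /S/= -scalemxAl !nsqZ exprVn sqr_sqrtr// mulVf// => /(_ erefl).
by rewrite ler_pdivrMl// mulrC.
Qed.

Let max_eigen m n (A : 'M[R]_(m, n)) (x : 'rV[R]_m) : nsq x = 1 ->
  (forall z, nsq (z *m A) <= nsq (x *m A) * nsq z) ->
  x *m A *m A^T = nsq (x *m A) *: x.
Proof.
move=> x1 xmax; set l := nsq (x *m A).
pose z := x *m A *m A^T - l *: x.
suff z0 : z = 0 by apply/eqP; rewrite -subr_eq0; apply/eqP.
apply: nsq_eq0.
have key t : 2 * t * nsq z <= t ^+ 2 * (l * nsq z).
  have := xmax (x + t *: z); rewrite mulmxDl -scalemxAl !nsqD x1 -/l.
  have -> : (x *m A *m (z *m A)^T) 0 0 = nsq z + l * (x *m z^T) 0 0.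
    have xE : x *m A *m A^T = z + l *: x by rewrite /z subrK.
    by rewrite trmx_mul mulmxA xE mulmxDl -scalemxAl [LHS]mxE
      [X in _ + X = _]mxE.
  have := mulr_ge0 (sqr_ge0 t) (nsq_ge0 (z *m A)).
  move: (nsq (z *m A)) (nsq z) ((x *m z^T) 0 0) => u q c; lra.
have l0 : 0 <= l := nsq_ge0 _.
apply/eqP; rewrite eq_le nsq_ge0 andbT.
have p : 0 < 1 + l by lra.
have up : 0 < (1 + l)^-1 by rewrite invr_gt0.
have h := key (1 + l)^-1; set u := (1 + l)^-1 in up h.
have ul : u * l = 1 - u by rewrite /u; field; rewrite gt_eqF.
have : u * (1 + u) * nsq z <= 0.
  by move: h; rewrite expr2 !mulrA -(mulrA u u l) ul => h; lra.
by rewrite pmulr_rle0// mulr_gt0//; lra.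
Qed.

Let householder m (x : 'rV[R]_m.+1) : nsq x = 1 -> exists2 Q : 'M[R]_m.+1,
  Q *m Q^T = 1%:M & delta_mx 0 0 *m Q = x.
Proof.
move=> x1; set e := delta_mx 0 0 : 'rV[R]_m.+1.
have [xe|xe] := eqVneq (nsq (x - e)) 0.
  exists 1%:M; first by rewrite trmx1 mulmx1.
  by rewrite mulmx1; apply/esym/eqP; rewrite -subr_eq0; apply/eqP/nsq_eq0.
have e1 : nsq e = 1.
  by rewrite /nsq /e trmx_delta mul_delta_mx mxE !eqxx.
set w := x - e in xe *; set q := nsq w in xe *.
have qE : w *m w^T = q%:M by rewrite [LHS]mx11_scalar.
have ew : e *m w^T = (- q / 2)%:M.
  rewrite [LHS]mx11_scalar; congr (_%:M).
  have := nsqD e w 1; rewrite scale1r /w addrC subrK x1 e1 -/w -/q => h.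
  by rewrite mulr1 expr1n mul1r in h; lra.
exists (1%:M - (2 / q) *: (w^T *m w)).
  rewrite [X in _ *m X](_ : _ = 1%:M - (2 / q) *: (w^T *m w)); last first.
    by apply/matrixP => i j; rewrite !mxE eq_sym; congr (_ - _ * _);
      apply: eq_bigr => k _; rewrite !mxE mulrC.
  set p := w^T *m w.
  have pp : p *m p = q *: p.
    by rewrite /p mulmxA -(mulmxA w^T) qE mul_mx_scalar -scalemxAl.
  rewrite mulmxBl !mulmxBr !mul1mx mulmx1 -scalemxAr -scalemxAl pp !scalerA.
  rewrite (_ : 2 / q * (2 / q) * q = 2 / q + 2 / q); last by field.
  by rewrite scalerDl; apply/matrixP => i j; rewrite !mxE; ring.
rewrite mulmxBr mulmx1 -scalemxAr mulmxA ew mul_scalar_mx scalerA.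
rewrite (_ : 2 / q * (- q / 2) = -1); last by field.
by rewrite scaleN1r opprK /w addrC subrK.
Qed.

Let svd_exists_bound m : forall n (A : 'M[R]_(m, n)), exists U s V,
  is_svd A U s V /\ forall b, 0 <= b ->
    (forall z, nsq (z *m A) <= b ^+ 2 * nsq z) -> s 0%N <= b.
Proof.
have triv p q (A : 'M[R]_(p, q)) : A = 0 -> exists U s V,
  is_svd A U s V /\ forall b, 0 <= b ->
    (forall z, nsq (z *m A) <= b ^+ 2 * nsq z) -> s 0%N <= b.
  move=> ->; exists 1%:M, (fun=> 0), 1%:M; split => //.
  split; rewrite ?trmx1 ?mulmx1 ?mul1mx//.
  by apply/matrixP => i j; rewrite !mxE mul0rn.
elim: m => [|m IH] [|n] A.
- by apply: triv; apply/matrixP => -[].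
- by apply: triv; apply/matrixP => -[].
- by apply: triv; apply/matrixP => i [].
have [x x1 xmax] := max_exists A.
have xeig := max_eigen x1 xmax.
set l := nsq (x *m A) in xmax xeig *.
have [l0|l0] := eqVneq l 0.
  apply: triv; apply/row_matrixP => i; rewrite row0 rowE.
  apply: nsq_eq0; apply/eqP; rewrite eq_le nsq_ge0 andbT.
  by apply: le_trans (xmax _) _; rewrite l0 mul0r.
have lp : 0 < l by rewrite lt_def l0 nsq_ge0.
pose sg := Num.sqrt l; have sgp : 0 < sg by rewrite sqrtr_gt0.
have sg2 : sg ^+ 2 = l by rewrite sqr_sqrtr// ltW.
pose y := sg^-1 *: (x *m A).
have y1 : nsq y = 1 by rewrite nsqZ exprVn sg2 mulVf.
have xA : x *m A = sg *: y by rewrite scalerA mulfV ?gt_eqF// scale1r.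
have yA : y *m A^T = sg *: x.
  rewrite -scalemxAl xeig scalerA -sg2; congr (_ *: _).
  by field; rewrite gt_eqF.
have [P PP eP] := householder x1; have [Q QQ eQ] := householder y1.
have PP' : P^T *m P = 1%:M by apply: mulmx1C.
have QQ' : Q^T *m Q = 1%:M by apply: mulmx1C.
have [B Bdef] : exists B : 'M[R]_(1 + m, 1 + n), B = P *m A *m Q^T.
  by exists (P *m A *m Q^T).
have Brow : delta_mx (0 : 'I_1) (0 : 'I_m.+1) *m B = sg *: delta_mx 0 0.
  by rewrite Bdef !mulmxA eP xA -scalemxAl -eQ -mulmxA QQ mulmx1.
have Bcol : delta_mx (0 : 'I_1) (0 : 'I_n.+1) *m B^T = sg *: delta_mx 0 0.
  by rewrite Bdef !trmx_mul trmxK !mulmxA eQ yA -scalemxAl -eP -mulmxA PP mulmx1.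
pose A' := drsubmx B.
have BE : B = block_mx sg%:M 0 0 A'.
  have r0 (i : 'I_m.+1) (j : 'I_n.+1) : i = 0 :> nat -> B i j = sg *+ (j == 0 :> nat).
    move=> i0; have -> : i = 0 :> 'I_m.+1 by apply/val_inj.
    have := congr1 (fun M : 'M[R]_(1, n.+1) => M 0 j) Brow.
    by rewrite -rowE !mxE eqxx/= mulr_natr.
  have c0 (i : 'I_m.+1) (j : 'I_n.+1) : j = 0 :> nat -> B i j = sg *+ (i == 0 :> nat).
    move=> j0; have -> : j = 0 :> 'I_n.+1 by apply/val_inj.
    have := congr1 (fun M : 'M[R]_(1, m.+1) => M 0 i) Bcol.
    by rewrite -rowE !mxE eqxx/= mulr_natr.
  rewrite -[LHS]submxK; congr block_mx.
  - by apply/matrixP => i j; rewrite !ord1 !mxE r0.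
  - by apply/matrixP => i j; rewrite !ord1 !mxE r0.
  - by apply/matrixP => i j; rewrite !ord1 !mxE c0.
have [U' [s' [V' [[U1 V1 [s0 sdec smin] A'E] sb]]]] := IH n A'.
have s'sg : s' 0%N <= sg.
  apply: sb (ltW sgp) _ => z.
  have -> : nsq (z *m A') = nsq (row_mx 0 z *m B).
    rewrite BE mul_row_block !mul0mx !mulmx0 !add0r.
    by rewrite /nsq tr_row_mx mul_row_col trmx0 mulmx0 add0r.
  rewrite Bdef mulmxA nsqM; last by rewrite trmxK.
  rewrite mulmxA sg2; apply: le_trans (xmax _) _; rewrite nsqM//.
  suff -> : nsq (row_mx (0 : 'rV[R]_1) z) = nsq z by [].
  by rewrite /nsq tr_row_mx mul_row_col trmx0 mulmx0 add0r.
pose s k := if k is k'.+1 then s' k' else sg.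
exists (P^T *m (block_mx 1%:M 0 0 U' : 'M[R]_(1 + m))), s,
  (Q^T *m (block_mx 1%:M 0 0 V' : 'M[R]_(1 + n))).
split; last first.
  move=> b b0 hb /=; rewrite -(@ler_pXn2r _ 2)// ?nnegrE ?(ltW sgp)// sg2.
  by have := hb x; rewrite x1 mulr1.
have orth k (K : 'M[R]_(1 + k)) (W : 'M[R]_k) : K *m K^T = 1%:M ->
    W^T *m W = 1%:M -> (K^T *m (block_mx 1%:M 0 0 W : 'M[R]_(1 + k)))^T *m
    (K^T *m (block_mx 1%:M 0 0 W : 'M[R]_(1 + k))) = 1%:M.
  move=> KK WW; rewrite trmx_mul trmxK mulmxA -(mulmxA _ K) KK mulmx1.
  rewrite tr_block_mx mulmx_block !trmx0 trmx1 !mulmx0 !mul0mx !addr0 !add0r.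
  by rewrite mulmx1 WW -scalar_mx_block.
split; [exact: orth|exact: orth| |].
  split => [[|k]|[|k] [|j]|[|k]]//=; first exact: ltW.
  - by move=> _; apply: le_trans s'sg; exact: sdec.
  - by move=> kj; exact: sdec.
  - by rewrite minnSS.
  - by rewrite minnSS; exact: smin.
have DE : rect_diag (1 + m) (1 + n) s = block_mx sg%:M 0 0 (rect_diag m n s').
  rewrite -[LHS]submxK; congr block_mx.
  - by apply/matrixP => i j; rewrite !ord1 !mxE.
  - by apply/matrixP => i j; rewrite !ord1 !mxE.
  - by apply/matrixP => i j; rewrite !ord1 !mxE.
  - by apply/matrixP => i j; rewrite !mxE.
have BD : B = (block_mx 1%:M 0 0 U' : 'M[R]_(1 + m)) *m
    rect_diag (1 + m) (1 + n) s *m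
    (block_mx 1%:M 0 0 V' : 'M[R]_(1 + n))^T.
  rewrite BE DE A'E tr_block_mx !mulmx_block !trmx0 trmx1.
  by rewrite !mulmx0 !mul0mx !addr0 !add0r !mulmx1 !mul1mx mul0mx.
have -> : A = P^T *m B *m Q.
  by rewrite Bdef !mulmxA PP' mul1mx -mulmxA QQ' mulmx1.
by rewrite BD trmx_mul trmxK !mulmxA.
Qed.

Lemma svd_exists m n (A : 'M[R]_(m, n)) : exists s U V, is_svd A U s V.
Proof. by have [U [s [V [h _]]]] := svd_exists_bound A; exists s, U, V. Qed.

End svd_existence.

(* j-th largest singular value, 1-based.                                      *)
Definition singular_value (R : realType) (m n : nat) (A : 'M[R]_(m, n))
    (j : nat) : R :=
  sval (cid (svd_exists A)) j.-1.

Lemma singular_valueP (R : realType) (m n : nat) (A : 'M[R]_(m, n)) :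
  exists U V, is_svd A U (fun k => singular_value A k.+1) V.
Proof. exact: svalP (cid (svd_exists A)). Qed.

(* B is a rank-r truncated SVD of A. This is a relation since the truncation  *)
(* is not unique when the r-th and (r+1)-th singular values of A coincide.    *)
Definition is_truncated_svd (R : realType) (m n r : nat)
    (A B : 'M[R]_(m, n)) : Prop :=
  exists U s V, is_svd A U s V /\
    B = U *m rect_diag m n (fun k => if (k < r)%N then s k else 0) *m V^T.

Section trace_regression.
Context d (T : measurableType d) (R : realType) (P : probability T R).

(* The sigma-algebra generated by a family of real-valued functions.          *)
Definition sigma_family (I : Type) (Z : I -> T -> R) : set (set T) :=
  <<s \bigcup_i preimage_set_system setT (Z i) measurable >>.

Definition mutually_independent (J : finType) (F : J -> set (set T)) : Prop :=
  forall E : J -> set T, (forall j, F j (E j)) ->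
  forall A : {set J},
    P (\bigcap_(j in [set` A]) E j) = (\prod_(j in A) P (E j))%E.

Variables (n d1 d2 : nat).

Definition design (X : 'I_n -> 'I_d1 -> 'I_d2 -> {RV P >-> R})
    (i : 'I_n) (w : T) : 'M[R]_(d1, d2) :=
  \matrix_(a, b) X i a b w.

Definition design_entries (X : 'I_n -> 'I_d1 -> 'I_d2 -> {RV P >-> R})
    (i : 'I_n) (k : 'I_d1 * 'I_d2) : T -> R :=
  X i k.1 k.2.

(* The coordinates of the pair (X_i, Y_i); None indexes Y_i.                  *)
Definition observation (X : 'I_n -> 'I_d1 -> 'I_d2 -> {RV P >-> R})
    (Y : 'I_n -> {RV P >-> R}) (i : 'I_n) (k : option ('I_d1 * 'I_d2)) :
    T -> R :=
  if k is Some k' then design_entries X i k' else Y i.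

(* The pairs (X_i, Y_i) are i.i.d.: tr_indep gives independence across i, and *)
(* they share one law by tr_normal, tr_entries, tr_noise_indep, tr_noise and  *)
(* tr_model. Laws are compared on measurable sets only, because a measure is  *)
(* an unconstrained function on the other sets.                               *)
Record trace_regression (M : 'M[R]_(d1, d2))
    (X : 'I_n -> 'I_d1 -> 'I_d2 -> {RV P >-> R})
    (xi Y : 'I_n -> {RV P >-> R}) (xi0 : {RV P >-> R}) : Prop := {
  tr_model : forall i w, Y i w = mxinner (design X i w) M + xi i w ;
  tr_indep : mutually_independent (fun i => sigma_family (observation X Y i)) ;
  tr_normal : forall i a b B, measurable B ->
    distribution P (X i a b) B = normal_prob 0 1 B ;
  tr_entries : forall i, mutually_independent
    (fun k => sigma_family (fun _ : unit => design_entries X i k)) ;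
  tr_noise_indep : forall i, mutually_independent
    (fun b : bool => if b then sigma_family (design_entries X i)
                     else sigma_family (fun _ : unit => xi i)) ;
  tr_noise : forall i B, measurable B ->
    distribution P (xi i) B = distribution P xi0 B ;
  tr_noise_mean : ('E_P[xi0] = 0)%E }.

End trace_regression.

(* Main.v *)
Require Import Defs.
From HB Require Import structures.
From mathcomp Require Import all_boot all_order all_algebra.
From mathcomp Require Import all_classical all_reals all_analysis.
From mathcomp Require Import measurable_realfun ring lra.

Set Implicit Arguments.
Unset Strict Implicit.
Unset Printing Implicit Defensive.

Import Order.TTheory GRing.Theory Num.Theory.
Import numFieldNormedType.Exports.

Local Open Scope classical_set_scope.
Local Open Scope ring_scope.

(** Write A for the average of the Y_i X_i, and D = A - M.  The proof bounds
    the spectral norm of D with high probability and concludes by a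
    deterministic perturbation argument.

    Perturbation.  Since M has rank r, Weyl's inequality gives
    s_(r+1)(A) <= |D| in spectral norm (svd_weyl), so the truncation M0 of A
    is at spectral distance at most 2|D| from M.  As M0 - M has rank at most
    2r, its Frobenius norm is at most 2 sqrt(2r) |D| (truncated_svd_error).
    It is therefore enough that |D| be a small multiple of sigma_r / sqrt r.

    Discretization.  The spectral norm is at most twice the largest value of
    u D v^T over lattice points u, v of mesh 1/(4 sqrt d) in the unit balls
    (svd_net_le), and there are at most e^(18 d) such points in dimension d
    (net_card).  A bound of order e^(-37 d1) at each pair of points is thus
    enough.

    Signal.  For fixed u, v, the signal part of u D v^T is an average of
    centered products g h of jointly Gaussian variables.  By polarization
    g h is a difference of squares, and the exponential moments of the square
    of a Gaussian variable s follow from the identity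
    exp(t s^2) = E_z exp(sqrt(2t) s z), z standard normal
    (gaussian_square_mgf).  Only the moment generating functions of linear
    combinations of the entries are used, never their laws.  This gives the
    Bernstein type bound signal_tail.

    Noise.  The noise part is an average of xi_i g_i, with g_i Gaussian and
    independent of the heavy-tailed xi_i.  The variable
    exp(t xi g - t^2 xi^2 v / 2) has mean 1 whatever the law of xi
    (gaussian_noise_mgf), so that the sum of the xi_i g_i has Gaussian tails
    on the event where the sum of the xi_i^2 is at most S^2 (noise_tail).
    That event contains the one where the sum of the |xi_i|^(1+eps) is less
    than S^(1+eps) (sum_le_of_powR), and Markov's inequality applies to the
    latter (noise_moment_tail).  The constants of the tail bounds can be made
    independent of eps because the level at which Markov's inequality is used
    is free: decreasing it only enlarges the coefficient of 1 / log d1 in the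
    failure probability (heavy_tail_budget). *)

(** * Singular values and bilinear forms *)

Section singular_values.
Context (R : realType).

(** The squared Euclidean norm of a row vector. *)
Definition sqnorm n (x : 'rV[R]_n) : R := \sum_j x 0 j ^+ 2.

(** The bilinear form x A y^T attached to A, on row vectors x and y. *)
Definition mxform m n (A : 'M[R]_(m, n)) (x : 'rV[R]_m) (y : 'rV[R]_n) : R :=
  (x *m A *m y^T) 0 0.

Lemma sqnorm_ge0 n (x : 'rV[R]_n) : 0 <= sqnorm x.
Proof. by rewrite sumr_ge0// => j _; exact: sqr_ge0. Qed.

Lemma sqnormE n (x : 'rV[R]_n) : sqnorm x = (x *m x^T) 0 0.
Proof. by rewrite mxE; apply: eq_bigr => j _; rewrite mxE expr2. Qed.

Lemma sqnorm_mul n (U : 'M[R]_n) (x : 'rV[R]_n) :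
  U^T *m U = 1%:M -> sqnorm (x *m U) = sqnorm x.
Proof.
move=> /mulmx1C UU; rewrite !sqnormE trmx_mul mulmxA -(mulmxA x).
by rewrite UU mulmx1.
Qed.

Lemma sqnorm_mul_tr n (U : 'M[R]_n) (x : 'rV[R]_n) :
  U^T *m U = 1%:M -> sqnorm (x *m U^T) = sqnorm x.
Proof. by move=> UU; apply: sqnorm_mul; rewrite trmxK; exact: mulmx1C. Qed.

Lemma sqnorm_delta n (i : 'I_n) : sqnorm (delta_mx 0 i) = 1.
Proof.
rewrite /sqnorm (bigD1 i)//= mxE !eqxx expr1n big1 ?addr0// => j /negbTE ji.
by rewrite mxE ji andbF expr0n.
Qed.

Lemma mxformD m n (A B : 'M[R]_(m, n)) x y :
  mxform (A + B) x y = mxform A x y + mxform B x y.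
Proof. by rewrite /mxform mulmxDr mulmxDl mxE. Qed.

Lemma mxformBl m n (A : 'M[R]_(m, n)) x x' y :
  mxform A (x - x') y = mxform A x y - mxform A x' y.
Proof. by rewrite /mxform !mulmxBl mxE [X in _ + X]mxE. Qed.

Lemma mxformBr m n (A : 'M[R]_(m, n)) x y y' :
  mxform A x (y - y') = mxform A x y - mxform A x y'.
Proof. by rewrite /mxform linearB/= mulmxBr mxE [X in _ + X]mxE. Qed.

Lemma sum_eq_ord_le1 n (k : nat) : \sum_(j < n) (k == j :> nat)%:R <= 1 :> R.
Proof.
have [kn|nk] := ltnP k n.
  rewrite (bigD1 (Ordinal kn))//= eqxx big1 ?addr0// => j jk.
  by case: eqP => // kj; case/negP: jk; apply/eqP/val_inj.
by rewrite big1// => j _; case: eqP => // kj; have := ltn_ord j; rewrite -kj ltnNge nk.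
Qed.

(** A bound on the bilinear form through a bound [B] on the [|s k|]. The
    arithmetic-geometric form with a free weight [c], instead of a product of
    norms, avoids square roots; the [s k] need neither be nonnegative nor
    sorted. *)
Lemma mxform_le m n (A : 'M[R]_(m, n)) U V (s : nat -> R) (B c : R) x y :
  U^T *m U = 1%:M -> V^T *m V = 1%:M -> A = U *m rect_diag m n s *m V^T ->
  (forall k, `|s k| <= B) -> 0 < c ->
  mxform A x y <= B * ((c * sqnorm x + sqnorm y / c) / 2).
Proof.
move=> UU VV AE sB c0; have B0 : 0 <= B := le_trans (normr_ge0 (s 0%N)) (sB 0%N).
rewrite -(sqnorm_mul x UU) -(sqnorm_mul y VV).
have -> : mxform A x y = mxform (rect_diag m n s) (x *m U) (y *m V).
  by rewrite /mxform AE trmx_mul !mulmxA.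
move: (x *m U) (y *m V) => {}x {}y.
have -> : mxform (rect_diag m n s) x y =
    \sum_(i < m) \sum_(j < n) (i == j :> nat)%:R * (s i * (x 0 i * y 0 j)).
  rewrite /mxform -mulmxA mxE; apply: eq_bigr => i _.
  rewrite mxE big_distrr/=; apply: eq_bigr => j _.
  by rewrite !mxE -mulr_natr; ring.
have term (i : 'I_m) (j : 'I_n) : s i * (x 0 i * y 0 j) <=
    B * ((c * x 0 i ^+ 2 + y 0 j ^+ 2 / c) / 2).
  apply: le_trans (ler_norm _) _; rewrite normrM.
  apply: ler_pM => //; rewrite normrM.
  have : 0 <= (c * `|x 0 i| - `|y 0 j|) ^+ 2 / c.
    by rewrite divr_ge0 ?sqr_ge0// ltW.
  rewrite -(real_normK (num_real (x 0 i))) -(real_normK (num_real (y 0 j))).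
  have -> : (c * `|x 0 i| - `|y 0 j|) ^+ 2 / c = c * `|x 0 i| ^+ 2 -
     2 * (`|x 0 i| * `|y 0 j|) + `|y 0 j| ^+ 2 / c by field; rewrite gt_eqF.
  lra.
apply: le_trans.
  apply: ler_sum => i _; apply: ler_sum => j _.
  by apply: ler_wpM2l (term i j); rewrite ler0n.
have -> : \sum_(i < m) \sum_(j < n) (i == j :> nat)%:R *
    (B * ((c * x 0 i ^+ 2 + y 0 j ^+ 2 / c) / 2)) =
  B * ((c * (\sum_(i < m) x 0 i ^+ 2 * \sum_(j < n) (i == j :> nat)%:R) +
    (\sum_(j < n) y 0 j ^+ 2 * \sum_(i < m) (j == i :> nat)%:R) / c) / 2).
  rewrite [X in (_ + X / c)](_ : _ =
      \sum_(i < m) \sum_(j < n) (i == j :> nat)%:R * y 0 j ^+ 2); last first.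
    rewrite exchange_big/=; apply: eq_bigr => j _; rewrite mulrC big_distrl/=.
    by apply: eq_bigr => i _; rewrite eq_sym.
  rewrite [X in (c * X + _)](_ : _ =
      \sum_(i < m) \sum_(j < n) (i == j :> nat)%:R * x 0 i ^+ 2); last first.
    by apply: eq_bigr => i _; rewrite mulrC big_distrl.
  rewrite big_distrr/= big_distrl/= -big_split/= big_distrl/= big_distrr/=.
  apply: eq_bigr => i _.
  rewrite big_distrr/= big_distrl/= -big_split/= big_distrl/= big_distrr/=.
  by apply: eq_bigr => j _; ring.
apply: ler_wpM2l => //; rewrite ler_pM2r ?invr_gt0//.
apply: lerD.
  rewrite ler_pM2l//; apply: ler_sum => i _.
  by rewrite ler_piMr ?sqr_ge0// sum_eq_ord_le1.
rewrite ler_pM2r ?invr_gt0//; apply: ler_sum => i _.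
by rewrite ler_piMr ?sqr_ge0// sum_eq_ord_le1.
Qed.

(** The case [y = x *m A], [c = B] of the previous bound; [c = 1] when [B]
    is 0. *)
Lemma sqnorm_mul_le m n (A : 'M[R]_(m, n)) U V (s : nat -> R) (B : R) x :
  U^T *m U = 1%:M -> V^T *m V = 1%:M -> A = U *m rect_diag m n s *m V^T ->
  (forall k, `|s k| <= B) -> sqnorm (x *m A) <= B ^+ 2 * sqnorm x.
Proof.
move=> UU VV AE sB; set y := x *m A.
have B0 : 0 <= B := le_trans (normr_ge0 (s 0%N)) (sB 0%N).
have yE : sqnorm y = mxform A x y by rewrite sqnormE /mxform.
have [a0|a0] := eqVneq B 0.
  have := mxform_le x y UU VV AE sB (@ltr01 R); rewrite a0 expr0n !mul0r -yE; exact.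
have ap : 0 < B by rewrite lt_def a0.
have := mxform_le x y UU VV AE sB ap; rewrite -yE.
have -> : B * ((B * sqnorm x + sqnorm y / B) / 2) =
  (B ^+ 2 * sqnorm x) / 2 + sqnorm y / 2 by field.
lra.
Qed.

(** The first [k.+1] diagonal entries are inverted; the others are cut off. *)
Lemma rect_diag_inv m n p (s t : nat -> R) k : (k < n)%N ->
  (forall j, (j <= k)%N -> s j * t j = 1) -> (forall j, (k < j)%N -> t j = 0) ->
  rect_diag m n s *m rect_diag n p t = pid_mx k.+1.
Proof.
move=> kn st t0; apply/matrixP => i j; rewrite !mxE ltnS.
have [ik|ki] := leqP i k; last first.
  rewrite andbF big1// => l _; rewrite !mxE.
  by have [il|_] := eqVneq (i : nat) l; rewrite ?mul0r// -il t0// mul0rn mulr0.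
rewrite andbT (bigD1 (Ordinal (leq_ltn_trans ik kn)))//= big1 ?addr0.
  by rewrite !mxE/= eqxx mulr1n mulrnAr st.
move=> l li; rewrite !mxE (_ : (i == l :> nat) = false) ?mul0r//.
by apply/negbTE; apply: contraNneq li => il; apply/eqP/val_inj.
Qed.

Lemma mxrank_rect_diag m n r (s : nat -> R) :
  (forall k, (r <= k)%N -> s k = 0) -> (\rank (rect_diag m n s) <= r)%N.
Proof.
move=> s0; have [mr|rm] := leqP m r; first exact: leq_trans (rank_leq_row _) mr.
have -> : rect_diag m n s = (pid_mx r : 'M[R]_m) *m rect_diag m n s.
  apply/matrixP => i j; rewrite [RHS]mxE (bigD1 i)//= big1 ?addr0.
    rewrite !mxE eqxx/=; have [_|ri] := ltnP i r; first by rewrite mul1r.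
    by rewrite s0// mul0rn mul0r.
  move=> l li; rewrite !mxE (_ : (i == l :> nat) = false) ?mul0r//.
  by apply/negbTE; rewrite eq_sym; rewrite -(inj_eq val_inj) in li.
by apply: leq_trans (mxrankM_maxl _ _) _; rewrite rank_pid_mx// ltnW.
Qed.

Section svd.
Variables (m n : nat) (A : 'M[R]_(m, n)) (U : 'M[R]_m) (s : nat -> R).
Variable V : 'M[R]_n.
Hypothesis svdA : is_svd A U s V.

(** The largest singular value is attained in the unit balls. When one of
    the dimensions is 0, the vectors are null and the value is 0. *)
Lemma svd_top : exists u v, [/\ sqnorm u <= 1, sqnorm v <= 1 & mxform A u v = s 0%N].
Proof.
have [UU VV [s0 sd sm] AE] := svdA.
have [/andP[m0 n0]|] := boolP ((0 < m)%N && (0 < n)%N); last first.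
  move=> mn; exists 0, 0; rewrite sm; last first.
    by move: mn; rewrite geq_min negb_and -!leqNgt.
  rewrite /sqnorm !big1; try by move=> j _; rewrite mxE expr0n.
  by split; rewrite ?ler01// /mxform !mul0mx mxE.
pose i0 := Ordinal m0; pose j0 := Ordinal n0.
exists (delta_mx 0 i0 *m U^T), (delta_mx 0 j0 *m V^T).
split; rewrite ?sqnorm_mul_tr// ?sqnorm_delta//.
rewrite /mxform AE trmx_mul trmxK !mulmxA -(mulmxA _ U^T) UU mulmx1.
rewrite -(mulmxA _ V^T) VV mulmx1 trmx_delta -rowE -colE !mxE.
by rewrite eqxx mulr1n.
Qed.

Lemma svd_mxform_le c x y : 0 < c ->
  mxform A x y <= s 0%N * ((c * sqnorm x + sqnorm y / c) / 2).
Proof.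
have [UU VV [s0 sd sm] AE] := svdA.
by apply: (mxform_le _ _ UU VV AE) => k; rewrite ger0_norm// sd.
Qed.

Lemma svd_sqnorm_le x : sqnorm (x *m A) <= s 0%N ^+ 2 * sqnorm x.
Proof.
have [UU VV [s0 sd _] AE] := svdA.
by apply: (sqnorm_mul_le _ UU VV AE) => k; rewrite ger0_norm// sd.
Qed.

Lemma svd_conj : rect_diag m n s = U^T *m A *m V.
Proof.
have [UU VV _ AE] := svdA.
by rewrite AE !mulmxA UU mul1mx -mulmxA VV mulmx1.
Qed.

Lemma svd_gt0_le k j : s k != 0 -> (j <= k)%N -> 0 < s j.
Proof.
have [_ _ [s0 sd _] _] := svdA => sk jk.
by rewrite (lt_le_trans _ (sd _ _ jk))// lt_def sk s0.
Qed.

Lemma svd_lt_mxrank k : s k != 0 -> (k < \rank A)%N.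
Proof.
have [UU VV [s0 sd sm] AE] := svdA; move=> sk.
have kmn : (k < minn m n)%N.
  by rewrite ltnNge; apply: contraNN sk => /sm ->.
have [km kn] : (k < m)%N /\ (k < n)%N by move: kmn; rewrite ltn_min => /andP[].
pose t j := if (j <= k)%N then (s j)^-1 else 0.
have E : rect_diag m n s *m rect_diag n n t = pid_mx k.+1.
  apply: rect_diag_inv => // j jk; rewrite /t; last by rewrite leqNgt jk.
  by rewrite jk mulfV// gt_eqF// (svd_gt0_le sk).
have <- : \rank (pid_mx k.+1 : 'M[R]_(m, n)) = k.+1 by rewrite rank_pid_mx.
rewrite -E svd_conj.
apply: leq_trans (mxrankM_maxl _ _) _.
by apply: leq_trans (mxrankM_maxl _ _) _; exact: mxrankM_maxr.
Qed.

Lemma svd_mxrank_gt0 : (0 < \rank A)%N -> 0 < s (\rank A).-1.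
Proof.
have [_ _ [s0 sd _] AE] := svdA => r0.
rewrite lt_def s0 andbT; apply/eqP => sr.
suff : (\rank A <= (\rank A).-1)%N by rewrite -ltnS prednK// ltnn.
rewrite {1}AE; apply: leq_trans (mxrankM_maxl _ _) _.
apply: leq_trans (mxrankM_maxr _ _) _; apply: mxrank_rect_diag => k rk.
by apply/eqP; rewrite eq_le s0 -sr sd.
Qed.

Lemma frobenius_sqr_le : mxinner A A <= (\rank A)%:R * s 0%N ^+ 2.
Proof.
have [UU VV [s0 sd sm] AE] := svdA.
have -> : mxinner A A = \sum_i \sum_j (rect_diag m n s i j) ^+ 2.
  transitivity (mxinner (rect_diag m n s) (rect_diag m n s)).
    rewrite /mxinner AE !trmx_mul trmxK !mulmxA -(mulmxA _ U^T) UU mulmx1.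
    by rewrite mxtrace_mulC !mulmxA VV mul1mx.
  rewrite /mxinner /mxtrace exchange_big/=; apply: eq_bigr => j _.
  by rewrite mxE; apply: eq_bigr => i _; rewrite mxE expr2.
apply: (@le_trans _ _ (\sum_(i < m) ((i < \rank A)%N%:R * s 0%N ^+ 2))).
  apply: ler_sum => i _.
  apply: (@le_trans _ _ (\sum_(j < n) (s i ^+ 2 * (i == j :> nat)%:R))).
    apply: ler_sum => j _; rewrite mxE; case: eqP => _.
      by rewrite mulr1 mulr1n.
    by rewrite mulr0n expr0n mulr0.
  rewrite -big_distrr/=.
  have h : s i ^+ 2 <= (i < \rank A)%N%:R * s 0%N ^+ 2.
    case: ltnP => ir.
      by rewrite mul1r lerXn2r// ?nnegrE// sd.
    rewrite mul0r (_ : s i = 0) ?expr0n//; apply/eqP.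
    by apply: contraTT ir => /svd_lt_mxrank; rewrite -ltnNge.
  apply: le_trans h; rewrite ler_piMr ?sqr_ge0// sum_eq_ord_le1//.
rewrite -big_distrl/= ler_wpM2r ?sqr_ge0//.
have -> : \sum_(i < m) (i < \rank A)%N%:R =
    \sum_(i < m | (i < \rank A)%N) 1 :> R.
  by rewrite [RHS]big_mkcond; apply: eq_bigr => i _; case: ifP.
by rewrite -(big_ord_widen _ (fun=> 1) (rank_leq_row A)) sumr_const card_ord.
Qed.

End svd.

(** Weyl's inequality for a perturbation of a matrix of rank at most [r]:
    some nonzero combination [x] of the first [r.+1] left singular vectors of
    [A] is killed by [M], and [x *m A = x *m (A - M)] has norm at least [s r]
    times that of [x]. The index [r] is 0-based: [s r] is the singular value
    of rank [r.+1]. *)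
Lemma svd_weyl m n r (A M : 'M[R]_(m, n)) U s V U' s' V' :
  is_svd A U s V -> is_svd (A - M) U' s' V' -> (\rank M <= r)%N ->
  s r <= s' 0%N.
Proof.
move=> svdA svdD rM; have [UU VV [s0 sd sm] AE] := svdA.
have [_ _ [s'0 _ _] _] := svdD.
have [->//|sr] := eqVneq (s r) 0.
have [rm rn] : (r < m)%N /\ (r < n)%N.
  by apply/andP; rewrite -ltn_min ltnNge; apply: contraNN sr => /sm ->.
have sgt j : (j <= r)%N -> 0 < s j by exact: (svd_gt0_le svdA sr).
(* K has r.+1 rows and rank at most r, hence a nonzero left kernel. *)
pose K := (pid_mx r.+1 : 'M[R]_(r.+1, m)) *m U^T *m M.
have : kermx K != 0.
  rewrite -mxrank_eq0 mxrank_ker -lt0n subn_gt0 ltnS.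
  exact: leq_trans (mxrankM_maxr _ _) rM.
move=> /rowV0Pn[z /sub_kermxP zK z0].
pose y := z *m (pid_mx r.+1 : 'M[R]_(r.+1, m)); pose x := y *m U^T.
have xM : x *m M = 0 by rewrite /x /y -zK /K !mulmxA.
have yz : sqnorm y = sqnorm z.
  rewrite !sqnormE trmx_mul mulmxA -(mulmxA z) tr_pid_mx pid_mx_id//.
  by rewrite pid_mx_1 mulmx1.
have zp : 0 < sqnorm z.
  rewrite lt_def sqnorm_ge0 andbT; apply: contraNneq z0 => /eqP.
  rewrite psumr_eq0; last by move=> j _; exact: sqr_ge0.
  move=> /allP h; apply/eqP/rowP => j; rewrite mxE.
  by have := h j (mem_index_enum _); rewrite sqrf_eq0 => /eqP.
have xA : sqnorm (x *m A) = sqnorm (y *m rect_diag m n s).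
  rewrite AE !mulmxA /x -(mulmxA y) UU mulmx1.
  by rewrite sqnorm_mul_tr.
have lower : sqnorm y <= (s r)^-1 ^+ 2 * sqnorm (y *m rect_diag m n s).
  pose t j := if (j <= r)%N then (s j)^-1 else 0.
  have {1}-> : y = y *m rect_diag m n s *m rect_diag n m t.
    rewrite -mulmxA (rect_diag_inv m m rn (s := s)).
    - by rewrite /y -mulmxA pid_mx_id.
    - by move=> j jr; rewrite /t jr mulfV// gt_eqF// sgt.
    - by move=> j; rewrite /t ltnNge => /negbTE ->.
  apply: (@sqnorm_mul_le _ _ _ 1%:M 1%:M t); rewrite ?trmx1 ?mulmx1 ?mul1mx//.
  move=> k; rewrite /t; case: ifP => kr.
    by rewrite ger0_norm ?invr_ge0// lef_pV2 ?posrE ?sgt// sd.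
  by rewrite normr0 invr_ge0.
have upper : sqnorm (x *m A) <= s' 0%N ^+ 2 * sqnorm x.
  have -> : x *m A = x *m (A - M) by rewrite mulmxBr xM subr0.
  exact: (svd_sqnorm_le svdD).
have xy : sqnorm x = sqnorm y by rewrite sqnorm_mul_tr.
rewrite -(@ler_pXn2r _ 2) ?nnegrE//.
rewrite -xA exprVn mulrC ler_pdivlMr ?exprn_gt0 ?sgt// mulrC in lower.
rewrite -(ler_pM2r zp) -yz; apply: le_trans lower _.
by rewrite -xy.
Qed.

(** Frobenius error of the truncated SVD of a perturbation of a matrix of
    rank at most [r]; it holds for every choice of the truncation. *)
Lemma truncated_svd_error m n r (A B M : 'M[R]_(m, n)) U s V :
  is_truncated_svd r A B -> is_svd (A - M) U s V -> (\rank M <= r)%N ->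
  mxinner (B - M) (B - M) <= 8 * r%:R * s 0%N ^+ 2.
Proof.
move=> [U1 [s1 [V1 [svdA BE]]]] svdD rM.
have [UU VV [s10 s1d s1m] AE] := svdA; have [_ _ [s0 _ _] _] := svdD.
have [s2 [U2 [V2 svdB]]] := svd_exists (B - M).
have [_ _ [s20 _ _] _] := svdB.
have rB : (\rank (B - M)%R <= r + r)%N.
  apply: leq_trans (mxrank_add _ _) _; rewrite mxrank_opp leq_add//.
  rewrite BE; apply: leq_trans (mxrankM_maxl _ _) _.
  apply: leq_trans (mxrankM_maxr _ _) _; apply: mxrank_rect_diag => k rk.
  by rewrite ltnNge rk.
have s2s : s2 0%N <= 2 * s 0%N.
  have [u [v [u1 v1 <-]]] := svd_top svdB.
  have -> : B - M = (B - A) + (A - M) by rewrite addrA subrK.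
  rewrite mxformD.
  have hle (b : R) : 0 <= b -> b * ((1 * sqnorm u + sqnorm v / 1) / 2) <= b.
    by move=> b0; rewrite ler_piMr//; lra.
  have h1 : mxform (A - M) u v <= s 0%N.
    exact: le_trans (svd_mxform_le svdD u v ltr01) (hle _ (s0 _)).
  have h2 : mxform (B - A) u v <= s1 r.
    pose t k := if (k < r)%N then 0 else - s1 k.
    have BA : B - A = U1 *m rect_diag m n t *m V1^T.
      rewrite BE AE -mulmxBl -mulmxBr; congr (_ *m _ *m _).
      apply/matrixP => i j; rewrite !mxE /t -mulrnBl.
      by case: ifP => _; rewrite ?subrr ?sub0r.
    apply: le_trans (mxform_le u v UU VV BA _ ltr01) (hle _ (s10 _)) => k.
    rewrite /t; case: ltnP => kr; first by rewrite normr0.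
    by rewrite normrN ger0_norm// s1d.
  have := svd_weyl svdA svdD rM; lra.
apply: le_trans (frobenius_sqr_le svdB) _.
have -> : 8 * r%:R * s 0%N ^+ 2 = (r + r)%:R * (2 * s 0%N) ^+ 2.
  by rewrite natrD; ring.
by apply: ler_pM; rewrite ?sqr_ge0 ?ler0n ?ler_nat// lerXn2r// nnegrE ?mulr_ge0.
Qed.

Lemma singular_value_gt0 (m n : nat) (A : 'M[R]_(m, n)) :
  (0 < \rank A)%N -> 0 < singular_value A (\rank A).
Proof.
move=> r0; have [U [V svdA]] := singular_valueP A.
by have := svd_mxrank_gt0 svdA r0; rewrite prednK.
Qed.

End singular_values.

(** * A lattice net of the unit ball *)

Section net.
Context (R : realType).

(** Signed integer vectors of dimension [d] with entries at most [4 * d] in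
    absolute value, as pairs of a sign and a magnitude. Zero has two codes,
    which only makes the count larger. *)
Definition net_index d := {ffun 'I_d -> bool * 'I_(4 * d).+1}.

(** The integer vectors of squared norm at most [16 * d]. *)
Definition net d : {set net_index d} :=
  [set f : net_index d | (\sum_j (f j).2 ^ 2 <= 16 * d)%N].

(** The lattice point of mesh [1 / (4 sqrt d)] coded by [f]. *)
Definition net_point d (f : net_index d) : 'rV[R]_d :=
  \row_j ((-1) ^+ (f j).1 * (f j).2%:R / (4 * Num.sqrt d%:R)).

Let mesh_sqr d : (4 * Num.sqrt d%:R) ^+ 2 = 16 * d%:R :> R.
Proof. by rewrite exprMn sqr_sqrtr ?ler0n//; ring. Qed.

Lemma net_point_le1 d (f : net_index d) : f \in net d ->
  sqnorm (net_point f) <= 1.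
Proof.
rewrite inE => fN; case: d => [|d] in f fN *.
  by rewrite /sqnorm big_ord0 ler01.
have dp : 0 < 16 * d.+1%:R :> R by rewrite mulr_gt0.
have -> : sqnorm (net_point f) = (\sum_j (f j).2 ^ 2)%N%:R / (16 * d.+1%:R).
  rewrite natr_sum big_distrl/=; apply: eq_bigr => j _.
  by rewrite mxE expr_div_n mesh_sqr exprMn sqrr_sign mul1r natrX.
by rewrite ler_pdivrMr// mul1r -natrM ler_nat.
Qed.

(** Rounding each coordinate towards zero stays in the ball and moves each
    coordinate by at most the mesh. *)
Lemma net_round d (u : 'rV[R]_d) : sqnorm u <= 1 ->
  exists2 f, f \in net d & sqnorm (u - net_point f) <= 1 / 16.
Proof.
move=> u1; case: d => [|d] in u u1 *.
  exists [ffun j => (false, ord0)]; first by rewrite inE big_ord0.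
  by rewrite /sqnorm big_ord0 divr_ge0.
set q := 4 * Num.sqrt d.+1%:R : R.
have q0 : 0 < q by rewrite mulr_gt0// sqrtr_gt0 ltr0n.
have qE : q ^+ 2 = 16 * d.+1%:R by exact: mesh_sqr.
pose k j := Num.truncn (q * `|u 0 j|).
have kle j : (k j)%:R <= q * `|u 0 j|.
  by rewrite truncn_le mulr_ge0// ltW.
have ksum : (\sum_j (k j) ^ 2 <= 16 * d.+1)%N.
  rewrite -(@ler_nat R) natr_sum natrM -qE.
  apply: (@le_trans _ _ (\sum_j (q ^+ 2 * u 0 j ^+ 2))).
    apply: ler_sum => j _; rewrite natrX -[in leRHS](real_normK (num_real (u 0 j))).
    by rewrite -exprMn lerXn2r// ?nnegrE ?ler0n// mulr_ge0// ltW.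
  by rewrite -big_distrr/= ler_piMr// sqr_ge0.
have kb j : (k j < (4 * d.+1).+1)%N.
  rewrite ltnS -(leq_exp2r _ _ (e := 2))//.
  apply: (@leq_trans (16 * d.+1)); last first.
    by rewrite expnMn leq_mul2l /= -{1}(expn1 d.+1) leq_pexp2l.
  apply: leq_trans ksum; rewrite (bigD1 j)//= leq_addr//.
exists [ffun j => (u 0 j < 0, Ordinal (kb j))].
  by rewrite inE; under eq_bigr do rewrite ffunE/=.
apply: (@le_trans _ _ (\sum_(j < d.+1) (16 * d.+1%:R)^-1)); last first.
  rewrite sumr_const card_ord -[leLHS]mulr_natr invfM -mulrA mulVf ?pnatr_eq0//.
  lra.
apply: ler_sum => j _; rewrite !mxE !ffunE/= -/q.
have -> : (u 0 j - (-1) ^+ (u 0 j < 0)%R * (k j)%:R / q) ^+ 2 =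
    ((q * `|u 0 j| - (k j)%:R) ^+ 2) / q ^+ 2.
  case: ltP => uj; rewrite ?expr1 ?expr0.
    by rewrite ltr0_norm//; field; rewrite gt_eqF.
  by rewrite ger0_norm//; field; rewrite gt_eqF.
rewrite -qE -[leRHS]mul1r ler_pM2r ?invr_gt0 ?exprn_gt0//.
have h0 : 0 <= q * `|u 0 j| by rewrite mulr_ge0// ltW.
have /andP[h1 h2] := truncn_itv h0; rewrite -/(k j) in h1 h2.
by rewrite expr_le1 ?subr_ge0//; move: h2; rewrite -natr1; lra.
Qed.

(** Each integer vector [k] of the net satisfies
    sum |k_j| <= sum k_j^2 <= 16 d, so that its weight, the product of the
    2^(-|k_j|), is at least 2^(-16 d); the total weight of all the integer
    vectors is at most 4^d. *)
Lemma net_card d : #|net d|%:R <= expR (18 * d%:R) :> R.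
Proof.
have half k : 0 < (2 : R)^-1 ^+ k by rewrite exprn_gt0// invr_gt0.
pose wt (f : net_index d) : R := \prod_j 2^-1 ^+ (f j).2.
have wtE f : wt f = 2^-1 ^+ (\sum_j (f j).2)%N by rewrite /wt prodrXr.
have wt0 f : 0 <= wt f by rewrite wtE ltW.
have step1 : #|net d|%:R <= 2 ^+ (16 * d) * \sum_f wt f.
  have -> : #|net d|%:R = \sum_(f in net d) 1 :> R by rewrite sumr_const.
  rewrite big_distrr/= [leRHS](bigID (mem (net d)))/=.
  apply: ler_wpDr.
    by apply: sumr_ge0 => f _; rewrite mulr_ge0// exprn_ge0.
  apply: ler_sum => f; rewrite inE => fN.
  rewrite wtE exprVn ler_pdivlMr ?exprn_gt0// mul1r.
  apply: ler_weXn2l; first by rewrite ler1n.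
  apply: leq_trans fN; apply: leq_sum => j _.
  by case: (nat_of_ord _) => // k; rewrite -{1}(expn1 k.+1) leq_pexp2l.
have geo N : \sum_(k < N) (2 : R)^-1 ^+ k <= 2.
  suff -> : \sum_(k < N) (2 : R)^-1 ^+ k = 2 - 2 * 2^-1 ^+ N.
    by have := half N; lra.
  elim: N => [|N IH]; first by rewrite big_ord0; lra.
  by rewrite big_ord_recr/= IH exprS; field.
have step2 : \sum_f wt f <= 4 ^+ d.
  rewrite /wt -(bigA_distr_bigA (fun (_ : 'I_d) (p : bool * 'I_(4 * d).+1) =>
    (2 : R)^-1 ^+ p.2)) prodr_const card_ord.
  apply: lerXn2r; rewrite ?nnegrE//; first by apply: sumr_ge0 => p _; rewrite ltW.
  rewrite -(pair_big xpredT xpredT (fun (_ : bool) (k : 'I_(4 * d).+1) =>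
    (2 : R)^-1 ^+ k))/= big_bool/=.
  by have := geo (4 * d).+1; lra.
apply: le_trans step1 _.
apply: (@le_trans _ _ (2 ^+ (18 * d))).
  have -> : 2 ^+ (18 * d) = 2 ^+ (16 * d) * 4 ^+ d :> R.
    rewrite (_ : 4 = 2 ^+ 2) -?exprM -?exprD; last by ring.
    by congr (_ ^+ _); ring.
  by rewrite ler_wpM2l// exprn_ge0.
have -> : expR (18 * d%:R) = expR 1 ^+ (18 * d) :> R.
  by rewrite -expRM_natl mulr1 natrM.
by apply: lerXn2r; rewrite ?nnegrE ?expR_ge0//; have := expR_ge1Dx (1 : R); lra.
Qed.

(** Replacing the top singular vectors by their roundings changes the form
    by at most a quarter of the top singular value, for each of the two. *)
Lemma svd_net_le m n (A : 'M[R]_(m, n)) U s V b : is_svd A U s V ->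
  (forall f g, f \in net m -> g \in net n ->
     mxform A (net_point f) (net_point g) <= b) -> s 0%N <= 2 * b.
Proof.
move=> svdA Ab; have [_ _ [s0 _ _] _] := svdA.
have [u [v [u1 v1 uv]]] := svd_top svdA.
have [f fN uf] := net_round u1; have [g gN vg] := net_round v1.
have E : mxform A u v = mxform A (net_point f) (net_point g) +
    mxform A (u - net_point f) v + mxform A (net_point f) (v - net_point g).
  by rewrite mxformBl mxformBr; ring.
have h1 : mxform A (u - net_point f) v <= s 0%N / 4.
  apply: le_trans (svd_mxform_le svdA _ _ (ltr0Sn _ 3)) _.
  by rewrite ler_wpM2l//; lra.
have h2 : mxform A (net_point f) (v - net_point g) <= s 0%N / 4.
  have c0 : 0 < 4^-1 :> R by rewrite invr_gt0.
  apply: le_trans (svd_mxform_le svdA _ _ c0) _.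
  by rewrite ler_wpM2l// invrK; have := net_point_le1 fN; lra.
have := Ab _ _ fN gN; lra.
Qed.

End net.

(** * Independence and expectation of products *)

Section image_density.
Context d d' (T : measurableType d) (T' : measurableType d') (R : realType).
Variables (mu : {measure set T -> \bar R}) (nu : {measure set T' -> \bar R}).
Variables (W : T -> R) (phi : T -> T') (c : R).
Hypotheses (W0 : forall x, 0 <= W x) (mW : measurable_fun setT W).
Hypothesis mphi : measurable_fun setT phi.
Hypothesis image : forall B, measurable B ->
  (\int[mu]_(x in phi @^-1` B) (W x)%:E = c%:E * nu B)%E.

Import HBNNSimple.

Let nnsfun_case (h : {nnsfun T' >-> R}) :
  (\int[mu]_x (W x * h (phi x))%:E = c%:E * \int[nu]_y (h y)%:E)%E.
Proof.
have mh r : measurable (h @^-1` [set r]) by exact: measurable_sfunP.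
have mWI r : measurable_fun [set: T]
    (fun x => (W x)%:E * (\1_(h @^-1` [set r]) (phi x))%:E : \bar R)%E.
  apply: emeasurable_funM; first exact/measurable_EFinP.
  by apply/measurable_EFinP; apply: measurableT_comp.
transitivity (\sum_(r \in range h)
   \int[mu]_x (r%:E * ((W x)%:E * (\1_(h @^-1` [set r]) (phi x))%:E)))%E.
  under eq_integral => x _.
    rewrite EFinM fimfunE -fsumEFin// ge0_mule_fsumr; last first.
      by move=> r; rewrite EFinM nnfun_muleindic_ge0.
    under eq_fsbigr do rewrite EFinM muleCA.
    over.
  rewrite ge0_integral_fsum//.
  - by move=> r; apply: emeasurable_funM => //; exact: measurable_cst.
  - move=> r x _; rewrite muleCA; apply: mule_ge0; first by rewrite lee_fin.
    exact: nnfun_muleindic_ge0.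
have -> : (\int[nu]_y (h y)%:E =
    \sum_(r \in range h) r%:E * nu (h @^-1` [set r]))%E.
  under eq_integral do rewrite fimfunE -fsumEFin//.
  rewrite ge0_integral_fsum//; last 2 first.
  - by move=> r; exact/measurable_EFinP/measurable_funM.
  - by move=> r x _; rewrite nnfun_muleindic_ge0.
  apply: eq_fsbigr => r _; rewrite integralZl_indic_nnsfun//.
  by rewrite integral_indic// setIT.
rewrite ge0_mule_fsumr; last first.
  move=> r; have [r0|r0] := leP 0 r; first by rewrite mule_ge0.
  by rewrite preimage_nnfun0// measure0 mule0.
apply: eq_fsbigr => r; rewrite inE => -[y _ <-].
rewrite ge0_integralZl//; last by rewrite lee_fin.
  2: by move=> x _; rewrite mule_ge0 ?lee_fin.
rewrite muleCA -image//; congr (_ * _)%E.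
rewrite [RHS]integral_mkcond; apply: eq_integral => x _.
rewrite patchE indicE; case: ifPn => [|] xB.
  by rewrite mem_set ?mule1//; move: xB; rewrite inE.
rewrite memNset ?mule0// => hx.
by move/negP: xB; apply; rewrite inE.
Qed.

(** If the image by [phi] of the measure of density [W] with respect to [mu]
    is [c] times [nu], integrals of nonnegative functions transfer
    accordingly. *)
Lemma ge0_integral_image_density (f : T' -> R) :
  (forall y, 0 <= f y) -> measurable_fun setT f ->
  (\int[mu]_x (W x * f (phi x))%:E = c%:E * \int[nu]_y (f y)%:E)%E.
Proof.
move=> f0 mf.
have mEf : measurable_fun setT (EFin \o f) by exact/measurable_EFinP.
pose f_ := nnsfun_approx measurableT mEf.
have cvf y : EFin \o f_ ^~ y @ \oo --> (f y)%:E.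
  by apply: cvg_nnsfun_approx => // z _; rewrite lee_fin.
have -> : (\int[nu]_y (f y)%:E = limn (fun n => \int[nu]_y (f_ n y)%:E))%E.
  rewrite -monotone_convergence//=.
  - by apply: eq_integral => y _; apply/esym/cvg_lim => //; exact: cvf.
  - by move=> n; exact/measurable_EFinP.
  - by move=> n x _; rewrite lee_fin.
  - by move=> x _ a b ab; rewrite lee_fin//; exact/lefP/nd_nnsfun_approx.
have -> : (\int[mu]_x (W x * f (phi x))%:E =
    limn (fun n => \int[mu]_x (W x * f_ n (phi x))%:E))%E.
  rewrite -monotone_convergence//=.
  - apply: eq_integral => x _; apply/esym/cvg_lim => //.
    under eq_fun do rewrite EFinM; rewrite EFinM.
    by apply: cvgeZl => //; exact: cvf.
  - move=> n; apply/measurable_EFinP/measurable_funM => //.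
    exact: measurableT_comp.
  - by move=> n x _; rewrite lee_fin mulr_ge0.
  - move=> x _ a b ab; rewrite lee_fin ler_wpM2l//.
    exact/lefP/nd_nnsfun_approx.
rewrite -limeMl//.
  by congr (limn _); apply/funext => n /=; rewrite nnsfun_case.
apply/ereal_nondecreasing_is_cvgn => a b ab; apply: ge0_le_integral => //.
- by move=> x _; rewrite lee_fin.
- exact/measurable_EFinP.
- exact/measurable_EFinP.
- by move=> x _; rewrite lee_fin; exact/lefP/nd_nnsfun_approx.
Qed.

End image_density.

Section independence.
Context d (T : measurableType d) (R : realType) (P : probability T R).

(** [f] is measurable with respect to the family of events [F]. *)
Definition adapted (F : set (set T)) (f : T -> R) : Prop :=
  forall B, measurable B -> F (f @^-1` B).

(** The expectation of a product of independent nonnegative variables with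
    finite means. The events {f j in B j} are replaced by the variables f j
    one index at a time, each replacement being an instance of
    [ge0_integral_image_density] with the product of the other factors as
    density. *)
Lemma expectation_prod (J : finType) (F : J -> set (set T))
    (f : J -> T -> R) (e : J -> R) :
  mutually_independent P F -> (forall j, measurable_fun setT (f j)) ->
  (forall j w, 0 <= f j w) -> (forall j, adapted (F j) (f j)) ->
  (forall j, \int[P]_w (f j w)%:E = (e j)%:E)%E ->
  (\int[P]_w (\prod_j f j w)%:E = (\prod_j e j)%:E)%E.
Proof.
move=> indep mf f0 Ff ef.
have e0 j : 0 <= e j.
  by rewrite -lee_fin -ef; apply: integral_ge0 => w _; rewrite lee_fin.
have mfB j B : measurable B -> measurable (f j @^-1` B).
  by move=> mB; rewrite -[X in measurable X]setTI; exact: mf.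
have step (s : seq J) : uniq s -> forall (A : {set J}) (B : J -> set R),
    (forall j, j \in s -> j \notin A) -> (forall j, measurable (B j)) ->
    (\int[P]_(w in \bigcap_(j in [set` A]) (f j @^-1` B j))
        (\prod_(j <- s) f j w)%:E =
     (\prod_(j <- s) e j)%:E * \prod_(j in A) P (f j @^-1` B j))%E.
  have mD (A : {set J}) (B : J -> set R) : (forall j, measurable (B j)) ->
      measurable (\bigcap_(j in [set` A]) (f j @^-1` B j)).
    move=> mB; apply: fin_bigcap_measurable; first exact: finite_finset.
    by move=> j _; exact: mfB.
  elim: s => [_ A B _ mB|j0 s IH /= /andP[j0s us] A B sA mB].
    under eq_integral do rewrite big_nil.
    rewrite integral_cst; last exact: mD.
    rewrite big_nil !mul1e. apply: (indep (fun j => f j @^-1` B j)) => j.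
    exact: Ff.
  have IHA : (\int[P]_(w in \bigcap_(j in [set` A]) (f j @^-1` B j))
        (\prod_(j <- s) f j w)%:E =
     (\prod_(j <- s) e j)%:E * \prod_(j in A) P (f j @^-1` B j))%E.
    by apply: IH => // j js; apply: sA; rewrite inE js orbT.
  have j0A : j0 \notin A by apply: sA; rewrite inE eqxx.
  pose p := \prod_(j in A) fine (P (f j @^-1` B j)).
  have pE : (\prod_(j in A) P (f j @^-1` B j) = p%:E)%E.
    rewrite /p -prodEFin; apply: eq_bigr => j _.
    by rewrite fineK// fin_num_measure//; exact: mfB.
  set D := \bigcap_(j in [set` A]) (f j @^-1` B j) in IHA *.
  have mDA : measurable D by exact: mD.
  pose W w := (\prod_(j <- s) f j w) * \1_D w.
  have W0 w : 0 <= W w by rewrite mulr_ge0// prodr_ge0.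
  have mprod (r : seq J) : measurable_fun setT (fun w => \prod_(j <- r) f j w).
    by apply: measurable_prod => j _.
  have mW : measurable_fun setT W by exact: measurable_funM.
  have intW C : measurable C -> (\int[P]_(w in C) (W w)%:E =
      \int[P]_(w in D `&` C) (\prod_(j <- s) f j w)%:E)%E.
    move=> mC; rewrite setIC [LHS]integral_mkcond [RHS]integral_mkcond.
    apply: eq_integral => w _; rewrite !patchE /W in_setI indicE.
    by case: (w \in C) => //=; case: (w \in D); rewrite ?mulr1 ?mulr0.
  pose X : {mfun T >-> R} := HB.pack (f j0) (isMeasurableFun.Build _ _ _ _ _ (mf j0)).
  have img C : measurable C -> (\int[P]_(w in f j0 @^-1` C) (W w)%:E =
      (\prod_(j <- s) e j * p)%:E * distribution P X C)%E.
    move=> mC; rewrite intW; last exact: mfB.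
    pose B' j := if j == j0 then C else B j.
    have B'A j : j \in A -> B' j = B j.
      by move=> jA; rewrite /B'; case: eqP jA j0A => // -> ->.
    have -> : D `&` f j0 @^-1` C =
        \bigcap_(j in [set` (j0 |: A)%SET]) (f j @^-1` B' j).
      apply/seteqP; split => w /=.
        move=> [Dw Cw] j /=; rewrite !inE => /orP[/eqP ->|jA].
          by rewrite /B' eqxx.
        by rewrite B'A//; exact: Dw.
      move=> h; split; last first.
        by have := h j0; rewrite /= /B' eqxx; apply; rewrite !inE eqxx.
      by move=> j /= jA; rewrite -B'A//; apply: h; rewrite /= !inE jA orbT.
    rewrite IH//; last 2 first.
    - move=> j js; rewrite !inE negb_or sA ?inE ?js ?orbT// andbT.
      by apply: contraNneq j0s => <-.
    - by move=> j; rewrite /B'; case: ifP.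
    rewrite big_setU1//= {1}/B' eqxx.
    rewrite (eq_bigr (fun j => P (f j @^-1` B j))); last first.
      by move=> j jA; rewrite B'A.
    by rewrite pE EFinM -muleA; congr (_ * _)%E; rewrite muleC.
  under eq_integral do rewrite big_cons.
  transitivity (\int[P]_w (W w * f j0 w)%:E)%E.
    rewrite integral_mkcond; apply: eq_integral => w _.
    rewrite patchE /W indicE; case: ifPn => wD; last by rewrite mulr0 mul0r.
    by rewrite mulr1 mulrC.
  (* The transfer lemma needs a function that is nonnegative everywhere. *)
  pose g (y : R) : R := Num.max y 0.
  transitivity (\int[P]_w (W w * g (f j0 w))%:E)%E.
    by apply: eq_integral => w _; rewrite /g max_l.
  rewrite (ge0_integral_image_density W0 mW (mf j0) img).
  - rewrite ge0_integral_distribution.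
    + have -> : (\int[P]_x ((fun y => (g y)%:E) \o X) x = (e j0)%:E)%E.
        rewrite -ef; apply: eq_integral => w _.
        by rewrite /= /g max_l// ?f0.
      by rewrite big_cons pE -!EFinM; congr (_%:E); ring.
    + apply/measurable_EFinP; exact: measurable_maxr.
    + by move=> y; rewrite lee_fin /g le_max lexx orbT.
  - by move=> y; rewrite /g le_max lexx orbT.
  - exact: measurable_maxr.
have := step _ (index_enum_uniq J) (finset.set0) (fun=> setT).
rewrite big_set0 mule1 => <- //; last by move=> j _; rewrite inE.
rewrite (_ : \bigcap_(_ in _) _ = setT)//.
by apply/seteqP; split => // w _ j /=; rewrite inE.
Qed.

End independence.

(** * Gaussian exponential moments *)

Section generated.
Context d (T : measurableType d) (R : realType) (I : Type) (Z : I -> T -> R).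

(** The events that generate [sigma_family Z]. *)
Definition family_system : set (set T) :=
  \bigcup_i preimage_set_system setT (Z i) measurable.

Lemma family_measurable i :
  measurable_fun [set: g_sigma_algebraType family_system] (Z i).
Proof.
by move=> _ B mB; apply: sub_sigma_algebra; exists i => //; exists B.
Qed.

Lemma adapted_family (f : T -> R) :
  measurable_fun [set: g_sigma_algebraType family_system] f ->
  adapted (sigma_family Z) f.
Proof. by move=> mf B mB; have := mf measurableT B mB; rewrite setTI. Qed.

End generated.
Arguments family_measurable {d T R I} Z i.

Section normal.
Context (R : realType).

Lemma ge0_integral_normal_prob (m s : R) (f : R -> R) :
  (forall x, 0 <= f x) -> measurable_fun setT f ->
  (\int[normal_prob m s]_x (f x)%:E =
   \int[lebesgue_measure]_x (normal_pdf m s x * f x)%:E)%E.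
Proof.
move=> f0 mf; rewrite -[LHS]mul1e; apply/esym.
apply: (@ge0_integral_image_density _ _ _ _ _ lebesgue_measure
  (normal_prob m s) (normal_pdf m s) idfun 1) => //.
- by move=> x; exact: normal_pdf_ge0.
- exact: measurable_normal_pdf.
- exact: measurable_id.
- by move=> B mB; rewrite mul1e.
Qed.

(** Laws compared with [normal_prob] on measurable sets only; [nu] may live
    on a different copy of the Borel sigma-algebra. *)
Lemma ge0_integral_normal_law (nu : {measure set R -> \bar R}) (m s : R)
    (f : R -> R) :
  (forall B : set R, measurable B -> nu B = normal_prob m s B) ->
  (forall x, 0 <= f x) -> measurable_fun setT f ->
  (\int[nu]_x (f x)%:E = \int[normal_prob m s]_x (f x)%:E)%E.
Proof.
move=> nuE f0 mf; rewrite ge0_integral_normal_prob// -[LHS]mul1e; apply/esym.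
apply: (@ge0_integral_image_density _ _ _ _ _ lebesgue_measure
  nu (normal_pdf m s) idfun 1) => //.
- by move=> x; exact: normal_pdf_ge0.
- exact: measurable_normal_pdf.
- exact: measurable_id.
- by move=> B mB; rewrite mul1e nuE.
Qed.

Lemma normal_mgf (t : R) :
  (\int[normal_prob 0 1]_x (expR (t * x))%:E = (expR (t ^+ 2 / 2))%:E)%E.
Proof.
rewrite ge0_integral_normal_prob; last 2 first.
- by move=> x; exact: expR_ge0.
- by apply: measurableT_comp => //; exact: measurable_funM => //.
transitivity (\int[lebesgue_measure]_x
  ((expR (t ^+ 2 / 2))%:E * (normal_pdf t 1 x)%:E))%E.
  apply: eq_integral => x _; rewrite -EFinM; congr (_%:E).
  rewrite !normal_pdfE ?oner_neq0// /normal_fun mulrCA -!mulrA -!expRD.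
  by congr (_ * expR _); field.
rewrite ge0_integralZl ?integral_normal_pdf ?mule1//.
- by apply/measurable_EFinP; exact: measurable_normal_pdf.
- by move=> x _; rewrite lee_fin normal_pdf_ge0.
Qed.

Lemma normal_square_mgf (x : R) : x < 1 / 2 ->
  (\int[normal_prob 0 1]_z (expR (x * z ^+ 2))%:E =
   ((Num.sqrt (1 - 2 * x))^-1)%:E)%E.
Proof.
move=> x2; have u0 : 0 < 1 - 2 * x by lra.
pose v : R := Num.sqrt (1 - 2 * x); have v0 : 0 < v by rewrite sqrtr_gt0.
have v2 : v ^+ 2 = 1 - 2 * x by rewrite sqr_sqrtr// ltW.
have s0 : v^-1 != 0 :> R by rewrite invr_eq0 gt_eqF.
rewrite ge0_integral_normal_prob; last 2 first.
- by move=> z; exact: expR_ge0.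
- apply: measurableT_comp => //; apply: measurable_funM => //.
transitivity (\int[lebesgue_measure]_z
  (v^-1%:E * (normal_pdf 0 v^-1 z)%:E))%E.
  apply: eq_integral => z _; rewrite -EFinM; congr (_%:E).
  rewrite !normal_pdfE ?oner_neq0// /normal_fun -[LHS]mulrA -expRD [RHS]mulrA.
  congr (_ * expR _).
    rewrite /normal_peak expr1n mul1r -mulrnAr sqrtrM ?sqr_ge0//.
    by rewrite sqrtr_sqr gtr0_norm ?invr_gt0// invfM invrK mulrA mulVf ?mul1r// gt_eqF.
  have -> : (v^-1 ^+ 2 *+ 2)^-1 = (1 - 2 * x) / 2.
    by rewrite -v2 -(mulr_natr _ 2); field; rewrite gt_eqF.
  by rewrite expr1n subr0; field.
rewrite ge0_integralZl ?integral_normal_pdf ?mule1//.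
- by apply/measurable_EFinP; exact: measurable_normal_pdf.
- by move=> z _; rewrite lee_fin normal_pdf_ge0.
- by rewrite lee_fin invr_ge0 ltW.
Qed.

End normal.

Section exponential_inequalities.
Context (R : realType).
Implicit Types x u : R.

(** [expR u + expR (- u) - 2] is [expR u * (1 - expR (- u)) ^+ 2]. *)
Lemma expRD_expRN_le u : 0 <= u ->
  expR u + expR (- u) <= 2 + u ^+ 2 * expR u.
Proof.
move=> u0; have e0 : 0 < expR u := expR_gt0 u.
have h1 : 1 - expR (- u) <= u by have := expR_ge1Dx (- u); lra.
have h2 : 0 <= 1 - expR (- u) by rewrite subr_ge0 -expR0 ler_expR; lra.
have h3 : (1 - expR (- u)) ^+ 2 <= u ^+ 2 by rewrite lerXn2r.
have ee : expR u * expR (- u) = 1 by rewrite -expRD subrr expR0.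
have : expR u * (1 - expR (- u)) ^+ 2 <= expR u * u ^+ 2.
  by rewrite ler_pM2l.
have -> : expR u * (1 - expR (- u)) ^+ 2 =
  expR u - 2 * (expR u * expR (- u)) + (expR u * expR (- u)) * expR (- u).
  by ring.
rewrite ee; lra.
Qed.

Lemma sqr_le_expR u : 0 <= u -> u ^+ 2 <= 4 * expR u.
Proof.
move=> u0; have h := expR_ge1Dx (u / 2).
have -> : expR u = expR (u / 2) ^+ 2 by rewrite expr2 -expRD; congr expR; field.
have : u ^+ 2 <= (2 * expR (u / 2)) ^+ 2.
  by rewrite lerXn2r// ?nnegrE; lra.
by rewrite exprMn; lra.
Qed.

Lemma inv_sqrt_ge x : 0 <= x -> x < 1 / 2 ->
  1 + x <= (Num.sqrt (1 - 2 * x))^-1.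
Proof.
move=> x0 x1; have u0 : 0 < 1 - 2 * x by lra.
rewrite -[leLHS]invrK lef_pV2 ?posrE ?sqrtr_gt0 ?invr_gt0; [|lra|lra].
have -> : (1 + x)^-1 = Num.sqrt ((1 + x)^-1 ^+ 2).
  by rewrite sqrtr_sqr gtr0_norm// invr_gt0; lra.
rewrite ler_wsqrtr// exprVn -[leRHS]mul1r ler_pdivlMr ?exprn_gt0//; last lra.
have : 0 <= x ^+ 2 * (3 + 2 * x) by rewrite mulr_ge0 ?sqr_ge0//; lra.
nra.
Qed.

Lemma inv_sqrt_le x : 0 <= x -> x <= 1 / 8 ->
  (Num.sqrt (1 - 2 * x))^-1 <= expR (x + 4 * x ^+ 2).
Proof.
move=> x0 x1; have u0 : 0 < 1 - 2 * x by lra.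
have e0 : 0 < expR (x + 4 * x ^+ 2) := expR_gt0 _.
rewrite -[leRHS]invrK lef_pV2 ?posrE ?sqrtr_gt0 ?invr_gt0//.
have -> : (expR (x + 4 * x ^+ 2))^-1 =
    Num.sqrt ((expR (x + 4 * x ^+ 2))^-1 ^+ 2).
  by rewrite sqrtr_sqr gtr0_norm// invr_gt0.
rewrite ler_wsqrtr// exprVn -[leLHS]mul1r ler_pdivrMr ?exprn_gt0//.
rewrite expr2 -expRD.
have := expR_ge1Dx (x + 4 * x ^+ 2 + (x + 4 * x ^+ 2)) => h.
apply: le_trans (ler_wpM2l (ltW u0) h).
have : 0 <= x ^+ 2 * (1 - 4 * x) by rewrite mulr_ge0 ?sqr_ge0//; lra.
nra.
Qed.

End exponential_inequalities.

Section gaussian_mgf.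
Context d (T : measurableType d) (R : realType) (P : probability T R).
Implicit Types (s g h : T -> R) (v t : R).

(** The variable [s] has the moment generating function of a centered normal
    variable of variance [v]. *)
Definition gaussian_mgf s v : Prop :=
  measurable_fun setT s /\
  forall t, (\int[P]_w (expR (t * s w))%:E = (expR (t ^+ 2 * v / 2))%:E)%E.

(** Linearization of the square by an auxiliary standard normal variable,
    followed by Tonelli's theorem. *)
Lemma gaussian_square_mgf s v t : gaussian_mgf s v -> 0 <= t -> t * v < 1 / 2 ->
  (\int[P]_w (expR (t * s w ^+ 2))%:E =
   ((Num.sqrt (1 - 2 * (t * v)))^-1)%:E)%E.
Proof.
move=> [ms smgf] t0 tv; set q := Num.sqrt (2 * t).
have q2 : q ^+ 2 = 2 * t by rewrite sqr_sqrtr//; lra.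
transitivity (\int[P]_w \int[normal_prob 0 1]_z (expR (q * s w * z))%:E)%E.
  apply: eq_integral => w _; rewrite normal_mgf; congr (expR _)%:E.
  by rewrite exprMn q2; field.
rewrite (fubini_tonelli (fun p : T * measurableTypeR R =>
  (expR (q * s p.1 * p.2))%:E))//=; last first.
  apply/measurable_EFinP; apply: measurableT_comp => //.
  apply: measurable_funM => //; apply: measurable_funM => //.
  exact: measurableT_comp.
transitivity (\int[normal_prob 0 1]_z (expR (t * v * z ^+ 2))%:E)%E.
  apply: eq_integral => z _.
  transitivity (\int[P]_w (expR (q * z * s w))%:E)%E.
    by apply: eq_integral => w _; congr (expR _)%:E; ring.
  by rewrite smgf exprMn q2; congr (expR _)%:E; field.
exact: normal_square_mgf.
Qed.

Lemma gaussian_square_upper s v t : gaussian_mgf s v -> 0 <= v -> 0 <= t ->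
  t * v <= 1 / 8 ->
  (\int[P]_w (expR (t * (s w ^+ 2 - v)))%:E <= (expR (4 * (t * v) ^+ 2))%:E)%E.
Proof.
move=> sv v0 t0 tv; have [ms _] := sv.
have x0 : 0 <= t * v by rewrite mulr_ge0.
have -> : (\int[P]_w (expR (t * (s w ^+ 2 - v)))%:E =
  (expR (- (t * v)))%:E * \int[P]_w (expR (t * s w ^+ 2))%:E)%E.
  rewrite -ge0_integralZl//.
  - by apply: eq_integral => w _; rewrite -EFinM -expRD; congr (expR _)%:E; ring.
  - apply/measurable_EFinP; apply: measurableT_comp => //.
    by apply: measurable_funM => //; exact: measurable_funX.
rewrite (gaussian_square_mgf sv t0); last lra.
rewrite -EFinM lee_fin mulrC.
have -> : expR (4 * (t * v) ^+ 2) =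
  expR (t * v + 4 * (t * v) ^+ 2) * expR (- (t * v)).
  by rewrite -expRD; congr expR; ring.
by rewrite ler_pM2r ?expR_gt0// inv_sqrt_le.
Qed.

(** The lower tail of the square is deduced from the exact value of the
    exponential moments with positive parameter, through
    [exp (- u) <= 2 - exp u + u ^ 2 exp u]; the second moment of [s] is not
    needed. *)
Lemma gaussian_square_lower s v t : gaussian_mgf s v -> 0 <= v -> 0 <= t ->
  t * v <= 1 / 8 ->
  (\int[P]_w (expR (- t * (s w ^+ 2 - v)))%:E <=
   (expR (364 * (t * v) ^+ 2))%:E)%E.
Proof.
move=> sv v0 t0 tv; have [ms _] := sv.
have x0 : 0 <= t * v by rewrite mulr_ge0.
have ms2 c : measurable_fun setT (fun w => (expR (c * s w ^+ 2))%:E).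
  apply/measurable_EFinP; apply: measurableT_comp => //.
  by apply: measurable_funM => //; exact: measurable_funX.
have -> : (\int[P]_w (expR (- t * (s w ^+ 2 - v)))%:E =
  (expR (t * v))%:E * \int[P]_w (expR (- t * s w ^+ 2))%:E)%E.
  rewrite -ge0_integralZl//.
  - by apply: eq_integral => w _; rewrite -EFinM -expRD; congr (expR _)%:E; ring.
set I : \bar R := (\int[P]_w _)%E.
have I0 : (0 <= I)%E by apply: integral_ge0 => w _; rewrite lee_fin expR_ge0.
have I1 : (I <= 1)%E.
  rewrite -(@probability_setT _ _ _ P) -[leRHS]mul1e -integral_cst//.
  apply: ge0_le_integral => // w _; rewrite lee_fin -[leRHS]expR0 ler_expR mulNr oppr_le0.
  by rewrite mulr_ge0// sqr_ge0.
have [v00|vp] := eqVneq v 0.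
  by rewrite v00 mulr0 expR0 mul1e expr0n mulr0 expR0.
have {}vp : 0 < v by rewrite lt_def vp.
(* 256 comes from y^2 <= 256 exp(y / 8); K is kept opaque, as are the other
   large numerals, to keep conversion tests away from them. *)
have [K KE] : exists K : R, K = 256%:R by exists 256%:R.
have K0 : 0 <= K by rewrite KE ler0n.
have key : (I + \int[P]_w (expR (t * s w ^+ 2))%:E <=
   (2 : R)%:E + (K * (t * v) ^+ 2)%:E * \int[P]_w (expR ((4 * v)^-1 * s w ^+ 2))%:E)%E.
  have -> : (2 : R)%:E = (\int[P]_w (2 : R)%:E)%E.
    by rewrite -[LHS]mule1 -(@probability_setT _ _ _ P) -integral_cst.
  rewrite -ge0_integralZl//; last by rewrite lee_fin mulr_ge0// sqr_ge0.
  have mr : measurable_fun setT (fun w => (K * (t * v) ^+ 2)%:E *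
      (expR ((4 * v)^-1 * s w ^+ 2))%:E)%E.
    by apply: emeasurable_funM => //; exact: measurable_cst.
  have r0 w : (0 <= (K * (t * v) ^+ 2)%:E *
      (expR ((4 * v)^-1 * s w ^+ 2))%:E)%E.
    by rewrite -EFinM lee_fin mulr_ge0 ?expR_ge0// mulr_ge0// sqr_ge0.
  rewrite -!ge0_integralD//.
  apply: ge0_le_integral => //.
  - by move=> w _; rewrite -EFinD lee_fin addr_ge0 ?expR_ge0.
  - exact: emeasurable_funD.
  - by apply: emeasurable_funD => //; exact: measurable_cst.
  move=> w _; rewrite -EFinM -!EFinD lee_fin.
  set y := s w ^+ 2 / v; have y0 : 0 <= y by rewrite divr_ge0 ?sqr_ge0.
  have sE : s w ^+ 2 = v * y by rewrite /y; field; rewrite gt_eqF.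
  rewrite sE addrC mulNr.
  apply: le_trans (expRD_expRN_le _) _; first by rewrite mulr_ge0// mulr_ge0.
  rewrite lerD2l.
  have -> : (4 * v)^-1 * (v * y) = y / 8 + y / 8 by field; rewrite gt_eqF.
  rewrite expRD [leRHS]mulrA.
  have h1 : expR (t * (v * y)) <= expR (y / 8).
    by rewrite ler_expR mulrA (mulrC y) ler_wpM2r//; lra.
  apply: ler_pM => //; rewrite ?sqr_ge0 ?expR_ge0//.
  have -> : (t * (v * y)) ^+ 2 = (t * v) ^+ 2 * y ^+ 2 by ring.
  rewrite -[leRHS]mulrA [leRHS]mulrCA ler_wpM2l ?sqr_ge0//.
  have := @sqr_le_expR R (y / 8); rewrite expr_div_n KE; lra.
have q2 : (Num.sqrt (1 - 2 * ((4 * v)^-1 * v)))^-1 <= 142 / 100 :> R.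
  have -> : 1 - 2 * ((4 * v)^-1 * v) = 1 / 2 :> R by field; rewrite gt_eqF.
  have -> : 142 / 100 = (Num.sqrt ((100 / 142) ^+ 2))^-1 :> R.
    by rewrite sqrtr_sqr gtr0_norm; lra.
  by rewrite lef_pV2 ?posrE ?sqrtr_gt0 ?ler_wsqrtr//; lra.
have v4 : (4 * v)^-1 * v = 1 / 4 by field; rewrite gt_eqF.
move: key; rewrite (gaussian_square_mgf sv t0); last lra.
rewrite (gaussian_square_mgf sv); [|by rewrite invr_ge0; lra|by rewrite v4; lra].
have Ifin : I \is a fin_num by rewrite ge0_fin_numE// (le_lt_trans I1)// ltry.
rewrite -(fineK Ifin) -!EFinM -!EFinD !lee_fin.
have := @inv_sqrt_ge R (t * v) x0; move: q2.
set r1 := (Num.sqrt _)^-1; set r2 := (Num.sqrt _)^-1; set i := fine I.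
move=> q2 h1 key; have {}h1 : 1 + t * v <= r2 by apply: h1; lra.
have h2 : K * (t * v) ^+ 2 * r1 <= K * (t * v) ^+ 2 * (142 / 100).
  by rewrite ler_wpM2l// mulr_ge0// sqr_ge0.
have h3 : i <= expR (- (t * v) + 364 * (t * v) ^+ 2).
  apply: le_trans (expR_ge1Dx _).
  have := sqr_ge0 (t * v); rewrite KE in h2 key; lra.
apply: le_trans (ler_wpM2l (expR_ge0 _) h3) _.
by rewrite -expRD ler_expR; lra.
Qed.

(** Polarization: [g h] is a quarter of the difference of the squares of
    [g + h] and [g - h], and [(vp - vm) / 4] is the mean of [g h]. *)
Lemma gaussian_product_mgf g h vp vm t :
  gaussian_mgf (fun w => g w + h w) vp -> gaussian_mgf (fun w => g w - h w) vm ->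
  0 <= vp <= 4 -> 0 <= vm <= 4 -> 0 <= t <= 1 / 16 ->
  (\int[P]_w (expR (t * (g w * h w - (vp - vm) / 4)))%:E <=
   (expR (1456 * t ^+ 2))%:E)%E.
Proof.
move=> gp gm /andP[vp0 vp4] /andP[vm0 vm4] /andP[t0 t16].
have [mp _] := gp; have [mm _] := gm.
pose A w := expR (t / 2 * ((g w + h w) ^+ 2 - vp)).
pose B w := expR (- (t / 2) * ((g w - h w) ^+ 2 - vm)).
have mA : measurable_fun setT A.
  apply: measurableT_comp => //; apply: measurable_funM => //.
  by apply: measurable_funB => //; exact: measurable_funX.
have mB : measurable_fun setT B.
  apply: measurableT_comp => //; apply: measurable_funM => //.
  by apply: measurable_funB => //; exact: measurable_funX.
have t20 : 0 <= t / 2 by lra.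
have bnd v : 0 <= v <= 4 -> 0 <= t / 2 * v <= 2 * t.
  by move=> /andP[v0 v4]; rewrite mulr_ge0//=; nra.
have bp : 0 <= t / 2 * vp <= 2 * t by apply: bnd; rewrite vp0.
have bm : 0 <= t / 2 * vm <= 2 * t by apply: bnd; rewrite vm0.
have sq x : 0 <= x <= 2 * t -> x ^+ 2 <= 4 * t ^+ 2.
  move=> /andP[x0 xt]; have : x ^+ 2 <= (2 * t) ^+ 2 by rewrite lerXn2r// nnegrE; lra.
  by rewrite exprMn; lra.
have IA : (\int[P]_w (A w)%:E <= (expR (1456 * t ^+ 2))%:E)%E.
  apply: le_trans (gaussian_square_upper gp vp0 t20 _) _; first lra.
  by rewrite lee_fin ler_expR; have := sq _ bp; have := sqr_ge0 t; lra.
have IB : (\int[P]_w (B w)%:E <= (expR (1456 * t ^+ 2))%:E)%E.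
  apply: le_trans (gaussian_square_lower gm vm0 t20 _) _; first lra.
  by rewrite lee_fin ler_expR; have := sq _ bm; lra.
apply: (@le_trans _ _ (\int[P]_w ((1 / 2)%:E * ((A w)%:E + (B w)%:E)))%E).
  apply: ge0_le_integral => //.
  - apply/measurable_EFinP; apply: measurableT_comp => //.
    apply: measurable_funM => //; apply: measurable_funB => //.
    rewrite (_ : (fun w => g w * h w) =
        (fun w => ((g w + h w) ^+ 2 - (g w - h w) ^+ 2) / 4)); last first.
      by apply/funext => w; field.
    by apply: measurable_funM => //; apply: measurable_funB; exact: measurable_funX.
  - apply: emeasurable_funM; first exact: measurable_cst.
    by apply: emeasurable_funD; exact/measurable_EFinP.
  move=> w _; rewrite -EFinD -EFinM lee_fin.
  pose a := expR (t / 4 * ((g w + h w) ^+ 2 - vp)).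
  pose b := expR (- (t / 4) * ((g w - h w) ^+ 2 - vm)).
  have -> : A w = a ^+ 2 by rewrite expr2 -expRD /A; congr expR; field.
  have -> : B w = b ^+ 2 by rewrite expr2 -expRD /B; congr expR; field.
  have -> : expR (t * (g w * h w - (vp - vm) / 4)) = a * b.
    by rewrite -expRD; congr expR; field.
  by have := sqr_ge0 (a - b); rewrite sqrrB; lra.
have mAE : measurable_fun setT (EFin \o A) by exact/measurable_EFinP.
have mBE : measurable_fun setT (EFin \o B) by exact/measurable_EFinP.
rewrite ge0_integralZl//; last 2 first.
- exact: emeasurable_funD.
- by move=> w _; rewrite -EFinD lee_fin addr_ge0 ?expR_ge0.
rewrite ge0_integralD//; last 2 first.
- by move=> w _; rewrite lee_fin expR_ge0.
- by move=> w _; rewrite lee_fin expR_ge0.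
have -> : ((expR (1456 * t ^+ 2))%:E =
  (1 / 2)%:E * ((expR (1456 * t ^+ 2))%:E + (expR (1456 * t ^+ 2))%:E))%E.
  by rewrite -EFinD -EFinM; congr (_%:E); field.
by apply: lee_wpmul2l; [rewrite lee_fin divr_ge0|exact: leeD].
Qed.

(** An exponential variable of mean 1 for any law of [xi]: given [xi], it is
    a normalized Gaussian exponential. The joint law of [xi] and [g] is the
    product of their laws, and Tonelli's theorem applies. *)
Lemma gaussian_noise_mgf (xi g : T -> R) v t : measurable_fun setT xi ->
  gaussian_mgf g v ->
  (forall A B, measurable A -> measurable B ->
     P (xi @^-1` A `&` g @^-1` B) = (P (xi @^-1` A) * P (g @^-1` B))%E) ->
  (\int[P]_w (expR (t * xi w * g w - t ^+ 2 * xi w ^+ 2 * v / 2))%:E = 1)%E.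
Proof.
move=> mxi [mg gmgf] indep.
pose xiX : {mfun T >-> R} := HB.pack xi (isMeasurableFun.Build _ _ _ _ _ mxi).
pose gX : {mfun T >-> R} := HB.pack g (isMeasurableFun.Build _ _ _ _ _ mg).
have mp : measurable_fun setT (fun w => (xi w, g w)).
  exact: measurable_fun_pair.
pose pX : {mfun T >-> (R * R)%type} :=
  HB.pack (fun w => (xi w, g w)) (isMeasurableFun.Build _ _ _ _ _ mp).
pose F (z : R * R) : \bar R :=
  (expR (t * z.1 * z.2 - t ^+ 2 * z.1 ^+ 2 * v / 2))%:E.
have mF : measurable_fun setT F.
  apply/measurable_EFinP; apply: measurableT_comp => //.
  apply: measurable_funB.
    by apply: measurable_funM => //; apply: measurable_funM.
  apply: measurable_funM => //; apply: measurable_funM => //.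
  apply: measurable_funM => //; exact: measurable_funX.
have F0 z : (0 <= F z)%E by rewrite lee_fin expR_ge0.
have prodE X : measurable X ->
    (distribution P xiX \x distribution P gX)%E X = distribution P pX X.
  by apply: product_measure_unique => A B mA mB; exact: indep.
transitivity (\int[P]_w (F \o pX) w)%E; first by [].
rewrite -ge0_integral_distribution//.
rewrite -(eq_measure_integral (distribution P pX)
   (fun A mA _ => prodE A mA)).
rewrite fubini_tonelli1//.
transitivity (\int[distribution P xiX]_x (cst 1%E x))%E.
  apply: eq_integral => x _; rewrite /fubini_F.
  rewrite (@ge0_integral_distribution _ _ _ _ _ P gX (fun y => F (x, y)))//; last first.
    exact: measurableT_comp.
  transitivity (\int[P]_w ((expR (- (t ^+ 2 * x ^+ 2 * v / 2)))%:E *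
     (expR (t * x * g w))%:E))%E.
    by apply: eq_integral => w _; rewrite /= /F -EFinM -expRD addrC.
  rewrite ge0_integralZl//.
    by rewrite gmgf -EFinM -expRD exprMn; rewrite addrC subrr expR0.
  apply/measurable_EFinP; apply: measurableT_comp => //.
  exact: measurable_funM.
rewrite integral_cst// mul1e.
exact: (@probability_setT _ _ _ (distribution P xiX)).
Qed.

End gaussian_mgf.

(** * Tails of sums of independent variables *)

Section large_deviations.
Context d (T : measurableType d) (R : realType) (P : probability T R).

Lemma measurable_superlevel (Z : T -> R) (a : R) : measurable_fun setT Z ->
  measurable [set w | a <= Z w].
Proof.
move=> mZ.
have := @measurable_fun_ler _ T R setT (cst a) Z (measurable_cst _) mZ.
by move=> /(_ measurableT [set true]); rewrite setTI; exact.
Qed.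

Lemma ge0_markov (Z : T -> R) (a : R) : measurable_fun setT Z ->
  (forall w, 0 <= Z w) -> 0 <= a ->
  (a%:E * P [set w | a <= Z w]%R <= \int[P]_w (Z w)%:E)%E.
Proof.
move=> mZ Z0 a0; pose A := [set w | a <= Z w].
have mA : measurable A := measurable_superlevel a mZ.
have mE : measurable_fun setT (fun w => (Z w)%:E) by exact/measurable_EFinP.
rewrite -integral_cst//.
apply: (@le_trans _ _ (\int[P]_(w in A) (Z w)%:E)%E).
  apply: ge0_le_integral => //; exact: measurable_funTS.
by apply: ge0_subset_integral => // w _; rewrite lee_fin.
Qed.

Lemma exp_markov (Z : T -> R) (a : R) : measurable_fun setT Z ->
  (P [set w | a <= Z w]%R <= (expR (- a))%:E * \int[P]_w (expR (Z w))%:E)%E.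
Proof.
move=> mZ.
have h : ((expR a)%:E * P [set w | a <= Z w]%R <= \int[P]_w (expR (Z w))%:E)%E.
  rewrite (_ : [set w | _] = [set w | expR a <= expR (Z w)]); last first.
    by apply/seteqP; split => w /=; rewrite ler_expR.
  apply: ge0_markov; [exact: measurableT_comp|by move=> w; exact: expR_ge0|].
  exact: expR_ge0.
have e0 : (0 <= (expR (- a))%:E)%E by rewrite lee_fin expR_ge0.
have := lee_wpmul2l e0 h.
by rewrite muleA -EFinM -expRD addNr expR0 mul1e.
Qed.

(** The Chernoff bound for a sum of independent variables. *)
Lemma sum_exp_tail (n : nat) (F : 'I_n -> set (set T)) (Z : 'I_n -> T -> R)
    (a b : R) :
  mutually_independent P F -> (forall i, measurable_fun setT (Z i)) ->
  (forall i, adapted (F i) (Z i)) ->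
  (forall i, \int[P]_w (expR (Z i w))%:E <= (expR b)%:E)%E ->
  (P [set w | a <= \sum_i Z i w]%R <= (expR (n%:R * b - a))%:E)%E.
Proof.
move=> indep mZ FZ Zb.
pose e i := fine (\int[P]_w (expR (Z i w))%:E)%E.
have eE i : (\int[P]_w (expR (Z i w))%:E = (e i)%:E)%E.
  rewrite /e fineK// ge0_fin_numE; first exact: le_lt_trans (Zb i) (ltry _).
  by apply: integral_ge0 => w _; rewrite lee_fin expR_ge0.
have mexp : measurable_fun setT (expR : R -> R) by exact: measurable_expR.
have prodE : (\int[P]_w (\prod_i expR (Z i w))%:E = (\prod_i e i)%:E)%E.
  apply: (expectation_prod indep) => // i.
  - exact: measurableT_comp.
  - move=> B mB; have := FZ i (expR @^-1` B); apply.
    by rewrite -[X in measurable X]setTI; exact: mexp.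
apply: le_trans (exp_markov a _) _; first exact: measurable_sum.
under eq_integral do rewrite expR_sum.
rewrite prodE -EFinM lee_fin addrC expRD ler_wpM2l ?expR_ge0//.
rewrite expRM_natl -[n in leRHS]card_ord -prodr_const.
apply: ler_prod => i _; rewrite -!lee_fin -eE Zb andbT.
by apply: integral_ge0 => w _; rewrite lee_fin expR_ge0.
Qed.

Lemma measure_bigsetU_le (I : eqType) (s : seq I) (A : I -> set T) (b : R) :
  (forall i, measurable (A i)) -> (forall i, i \in s -> P (A i) <= b%:E)%E ->
  (P (\big[setU/set0]_(i <- s) A i) <= ((size s)%:R * b)%:E)%E.
Proof.
move=> mA; elim: s => [_|i s IH Ab]; first by rewrite big_nil measure0 mul0r.
rewrite big_cons /= -natr1 mulrDl mul1r addrC EFinD.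
have mU : measurable (\big[setU/set0]_(j <- s) A j).
  by apply: bigsetU_measurable => j _.
apply: le_trans (measureU2 _ (mA i) mU) _; apply: leeD.
  by apply: Ab; rewrite inE eqxx.
by apply: IH => j js; apply: Ab; rewrite inE js orbT.
Qed.

End large_deviations.

(** * The inner product of matrices *)

Section matrix_inner_product.
Context (R : realType) (m n : nat).
Implicit Types A B C : 'M[R]_(m, n).

Lemma mxinnerE A B : mxinner A B = \sum_i \sum_j A i j * B i j.
Proof.
rewrite /mxinner /mxtrace exchange_big/=; apply: eq_bigr => j _.
by rewrite mxE; apply: eq_bigr => i _; rewrite mxE.
Qed.

Lemma mxinnerC A B : mxinner A B = mxinner B A.
Proof.
by rewrite !mxinnerE; apply: eq_bigr => i _; apply: eq_bigr => j _; rewrite mulrC.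
Qed.

Lemma mxinnerDr A B C : mxinner A (B + C) = mxinner A B + mxinner A C.
Proof. by rewrite /mxinner mulmxDr mxtraceD. Qed.

Lemma mxinnerBr A B C : mxinner A (B - C) = mxinner A B - mxinner A C.
Proof. by rewrite /mxinner mulmxBr raddfB. Qed.

Lemma mxinnerDl A B C : mxinner (A + B) C = mxinner A C + mxinner B C.
Proof. by rewrite mxinnerC mxinnerDr !(mxinnerC C). Qed.

Lemma mxinnerBl A B C : mxinner (A - B) C = mxinner A C - mxinner B C.
Proof. by rewrite mxinnerC mxinnerBr !(mxinnerC C). Qed.

Lemma mxinnerZr A B c : mxinner A (c *: B) = c * mxinner A B.
Proof. by rewrite /mxinner -scalemxAr mxtraceZ. Qed.

Lemma mxinnerZl A B c : mxinner (c *: A) B = c * mxinner A B.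
Proof. by rewrite mxinnerC mxinnerZr mxinnerC. Qed.

Lemma mxinner_suml k (A : 'I_k -> 'M[R]_(m, n)) B :
  mxinner (\sum_i A i) B = \sum_i mxinner (A i) B.
Proof.
apply: (big_morph (fun A => mxinner A B)) => [A1 A2|].
  exact: mxinnerDl.
by rewrite /mxinner trmx0 mul0mx mxtrace0.
Qed.

Lemma mxinner_ge0 A : 0 <= mxinner A A.
Proof.
rewrite mxinnerE; apply: sumr_ge0 => i _; apply: sumr_ge0 => j _.
by rewrite -expr2 sqr_ge0.
Qed.

Lemma mxform_inner A u v : mxform A u v = mxinner A (u^T *m v).
Proof.
rewrite /mxform mxinnerE -mulmxA mxE; apply: eq_bigr => i _.
rewrite mxE big_distrr/=; apply: eq_bigr => j _.
by rewrite !mxE big_ord1 !mxE; ring.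
Qed.

Lemma mxinner_outer (u : 'rV[R]_m) (v : 'rV[R]_n) :
  mxinner (u^T *m v) (u^T *m v) = sqnorm u * sqnorm v.
Proof.
rewrite mxinnerE /sqnorm big_distrl/=; apply: eq_bigr => i _.
rewrite big_distrr/=; apply: eq_bigr => j _.
by rewrite mxE big_ord1 !mxE; ring.
Qed.

End matrix_inner_product.

(** * Linear functionals of the Gaussian design *)

Section gaussian_design.
Context d (T : measurableType d) (R : realType) (P : probability T R).
Variables (n d1 d2 : nat) (M : 'M[R]_(d1, d2)).
Variables (X : 'I_n -> 'I_d1 -> 'I_d2 -> {RV P >-> R}).
Variables (xi Y : 'I_n -> {RV P >-> R}) (xi0 : {RV P >-> R}).
Hypothesis model : trace_regression M X xi Y xi0.
Implicit Types (A B : 'M[R]_(d1, d2)).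

Lemma design_innerE i B w : mxinner (design X i w) B =
  \sum_(k : 'I_d1 * 'I_d2) X i k.1 k.2 w * B k.1 k.2.
Proof.
rewrite mxinnerE pair_big/=; apply: eq_bigr => k _.
by rewrite mxE.
Qed.

Lemma measurable_design_inner i B :
  measurable_fun setT (fun w => mxinner (design X i w) B).
Proof.
under eq_fun do rewrite design_innerE.
by apply: measurable_sum => k; apply: measurable_funM.
Qed.

Lemma adapted_design_inner i B :
  adapted (sigma_family (design_entries X i))
    (fun w => mxinner (design X i w) B).
Proof.
apply: adapted_family; under eq_fun do rewrite design_innerE.
apply: measurable_sum => k; apply: measurable_funM; last exact: measurable_cst.
exact: (family_measurable (design_entries X i) k).
Qed.

Lemma design_inner_obs_measurable i B : measurable_fun
  [set: g_sigma_algebraType (family_system (observation X Y i))]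
  (fun w => mxinner (design X i w) B).
Proof.
under eq_fun do rewrite design_innerE.
apply: measurable_sum => k; apply: measurable_funM; last exact: measurable_cst.
exact: (family_measurable (observation X Y i) (Some k)).
Qed.

(** The noise is recovered from the observation as [Y i - <X i, M>]. *)
Lemma noise_obs_measurable i : measurable_fun
  [set: g_sigma_algebraType (family_system (observation X Y i))] (xi i).
Proof.
have -> : (xi i : T -> R) = fun w => Y i w - mxinner (design X i w) M.
  by apply/funext => w; rewrite (tr_model model) addrC addKr.
apply: measurable_funB; last exact: design_inner_obs_measurable.
exact: (family_measurable (observation X Y i) None).
Qed.

Lemma design_entry_mgf i a b t :
  (\int[P]_w (expR (t * X i a b w))%:E = (expR (t ^+ 2 / 2))%:E)%E.
Proof.
have mf : measurable_fun setT (fun x : R => (expR (t * x))%:E).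
  by apply/measurable_EFinP; apply: measurableT_comp => //; exact: measurable_funM.
transitivity (\int[distribution P (X i a b)]_x (expR (t * x))%:E)%E.
  by rewrite ge0_integral_distribution// => x; rewrite lee_fin expR_ge0.
rewrite (@ge0_integral_normal_law _ _ 0 1)//.
- exact: normal_mgf.
- by move=> B mB; exact: (tr_normal model).
- by apply: measurableT_comp => //; exact: measurable_funM.
Qed.

(** Inner products of the design with fixed matrices behave as centered
    Gaussian variables of variance the squared Frobenius norm. *)
Lemma design_inner_gaussian i B :
  gaussian_mgf P (fun w => mxinner (design X i w) B) (mxinner B B).
Proof.
split=> [|t]; first exact: measurable_design_inner.
transitivity (\int[P]_w (\prod_(k : 'I_d1 * 'I_d2)
    expR (t * B k.1 k.2 * X i k.1 k.2 w))%:E)%E.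
  apply: eq_integral => w _; rewrite design_innerE -expR_sum big_distrr/=.
  by congr (expR _)%:E; apply: eq_bigr => k _; ring.
have [_ _ _ entries _ _ _] := model.
rewrite (expectation_prod (entries i)
  (e := fun k => expR ((t * B k.1 k.2) ^+ 2 / 2))).
- rewrite -expR_sum mxinnerE pair_big/=; congr (expR _)%:E.
  rewrite big_distrr/= big_distrl/=; apply: eq_bigr => k _.
  by rewrite exprMn (expr2 (B _ _)).
- by move=> k; apply: measurableT_comp => //; exact: measurable_funM.
- by move=> k w; exact: expR_ge0.
- move=> k; apply: adapted_family; apply: measurableT_comp => //.
  apply: measurable_funM; first exact: measurable_cst.
  exact: (family_measurable (fun _ : unit => design_entries X i k) tt).
- by move=> k; exact: design_entry_mgf.
Qed.

Lemma noise_design_independent i B (S S' : set R) : measurable S -> measurable S' ->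
  P (xi i @^-1` S `&` (fun w => mxinner (design X i w) B) @^-1` S') =
  (P (xi i @^-1` S) * P ((fun w => mxinner (design X i w) B) @^-1` S'))%E.
Proof.
move=> mS mS'; set g := fun w => _.
have [_ _ _ _ indep _ _] := model.
have := indep i (fun b : bool => if b then g @^-1` S' else xi i @^-1` S).
have h (b : bool) : (if b then sigma_family (design_entries X i)
    else sigma_family (fun _ : unit => xi i))
    (if b then g @^-1` S' else xi i @^-1` S).
  case: b; first exact: adapted_design_inner.
  apply: adapted_family mS.
  exact: (family_measurable (fun _ : unit => xi i : T -> R) tt).
move=> /(_ h [set: bool]%SET).
rewrite (eq_bigl xpredT); last by move=> b; rewrite inE.
rewrite big_bool/= muleC => <-; congr (P _).
apply/seteqP; split => w /=.
  by move=> [xA gA] [] _.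
by move=> h'; split; [apply: (h' false)|apply: (h' true)]; rewrite /= inE.
Qed.

End gaussian_design.
Arguments noise_obs_measurable {d T R P n d1 d2 M X xi Y xi0} model i.

(** * Signal and noise in trace regression *)

Section tail_bounds.
Context d (T : measurableType d) (R : realType) (P : probability T R).
Variables (n d1 d2 : nat) (M : 'M[R]_(d1, d2)).
Variables (X : 'I_n -> 'I_d1 -> 'I_d2 -> {RV P >-> R}).
Variables (xi Y : 'I_n -> {RV P >-> R}) (xi0 : {RV P >-> R}).
Hypothesis model : trace_regression M X xi Y xi0.

(** Deviations of the average of the [g_i h_i], where [g_i = u X_i v^T] and
    [h_i = <X_i, M> / L], with [L] the Frobenius norm of [M]. *)
Lemma signal_tail (L tau : R) (u : 'rV[R]_d1) (v : 'rV[R]_d2) :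
  0 < L -> mxinner M M = L ^+ 2 -> sqnorm u <= 1 -> sqnorm v <= 1 ->
  0 < tau <= 182 ->
  (P [set w | (n%:R * tau <= \sum_i (mxinner (design X i w) (u^T *m v) *
        (mxinner (design X i w) M / L) - mxform M u v / L))%R] <=
   (expR (- (n%:R * tau ^+ 2 / 5824)))%:E)%E.
Proof.
move=> L0 ML u1 v1 /andP[t0 t182].
pose B := u^T *m v; pose B' := L^-1 *: M.
have B1 : mxinner B B <= 1.
  rewrite mxinner_outer -[leRHS]mul1r.
  by apply: ler_pM => //; exact: sqnorm_ge0.
have B'1 : mxinner B' B' = 1.
  rewrite mxinnerZr mxinnerC mxinnerZr ML; field; rewrite gt_eqF//.
pose vp := mxinner (B + B') (B + B'); pose vm := mxinner (B - B') (B - B').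
(* By the parallelogram identity vp + vm <= 4. *)
have vpE : vp = mxinner B B + 1 + 2 * mxinner B B'.
  by rewrite /vp mxinnerDr !mxinnerDl B'1 (mxinnerC B' B); ring.
have vmE : vm = mxinner B B + 1 - 2 * mxinner B B'.
  by rewrite /vm mxinnerBr !mxinnerBl B'1 (mxinnerC B' B); ring.
have vp0 : 0 <= vp := mxinner_ge0 _.
have vm0 : 0 <= vm := mxinner_ge0 _.
have [vp4 vm4] : vp <= 4 /\ vm <= 4.
  by move: vp0 vm0; rewrite vpE vmE => vp0 vm0; split; lra.
have rhoE : (vp - vm) / 4 = mxform M u v / L.
  by rewrite vpE vmE mxform_inner (mxinnerC M) /B' mxinnerZr -/B; field; rewrite gt_eqF.
have [N NE] : exists N : R, N = 2912%:R by exists 2912%:R.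
(* The minimizer of 1456 lam^2 - lam tau. *)
pose lam := tau / N.
have N0 : 0 < N by rewrite NE ltr0n.
have lam0 : 0 < lam by rewrite divr_gt0.
have lam16 : 0 <= lam <= 1 / 16.
  by rewrite ltW//= ler_pdivrMr// NE; lra.
pose Z i w := lam * (mxinner (design X i w) B * mxinner (design X i w) B' -
   (vp - vm) / 4).
have -> : [set w | n%:R * tau <= \sum_i (mxinner (design X i w) (u^T *m v) *
        (mxinner (design X i w) M / L) - mxform M u v / L)] =
    [set w | lam * (n%:R * tau) <= \sum_i Z i w].
  have ZE w : \sum_i Z i w = lam * \sum_i (mxinner (design X i w) (u^T *m v) *
        (mxinner (design X i w) M / L) - mxform M u v / L).
    rewrite big_distrr/=; apply: eq_bigr => i _.
    by rewrite /Z rhoE /B' mxinnerZr (mulrC L^-1).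
  by apply/seteqP; split => w /=; rewrite ZE ler_pM2l.
have [_ indep _ _ _ _ _] := model.
have e1 : n%:R * (1456 * lam ^+ 2) - lam * (n%:R * tau) =
    - (n%:R * tau ^+ 2 / 5824).
  by rewrite /lam NE; field.
rewrite -e1; apply: (sum_exp_tail _ indep).
- move=> i; apply: measurable_funM => //; apply: measurable_funB => //.
  by apply: measurable_funM; exact: measurable_design_inner.
- move=> i; apply: adapted_family.
  apply: measurable_funM; first exact: measurable_cst.
  apply: measurable_funB; last exact: measurable_cst.
  by apply: measurable_funM; exact: design_inner_obs_measurable.
- move=> i; apply: gaussian_product_mgf => //.
  + have -> : (fun w => mxinner (design X i w) B + mxinner (design X i w) B') =
        (fun w => mxinner (design X i w) (B + B')).
      by apply/funext => w; rewrite mxinnerDr.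
    exact: (design_inner_gaussian model).
  + have -> : (fun w => mxinner (design X i w) B - mxinner (design X i w) B') =
        (fun w => mxinner (design X i w) (B - B')).
      by apply/funext => w; rewrite mxinnerBr.
    exact: (design_inner_gaussian model).
  + by rewrite vp0.
  + by rewrite vm0.
Qed.

(** The self-normalized sum of the [xi_i <X_i, B>] has exponential tails,
    with no moment condition on the noise. *)
Lemma noise_tail (lam a : R) B :
  (P [set w | (a <= \sum_i (lam * xi i w * mxinner (design X i w) B -
        lam ^+ 2 * xi i w ^+ 2 * mxinner B B / 2))%R] <= (expR (- a))%:E)%E.
Proof.
have [_ indep _ _ _ _ _] := model.
have := @sum_exp_tail _ _ _ P n _ (fun i w => lam * xi i w *
  mxinner (design X i w) B - lam ^+ 2 * xi i w ^+ 2 * mxinner B B / 2) a 0 indep.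
rewrite mulr0 sub0r; apply.
- move=> i; apply: measurable_funB.
    by apply: measurable_funM; [exact: measurable_funM|exact: measurable_design_inner].
  apply: measurable_funM => //; apply: measurable_funM => //.
  by apply: measurable_funM => //; exact: measurable_funX.
- move=> i; apply: adapted_family.
  have mxi := noise_obs_measurable model i.
  apply: measurable_funB.
    apply: measurable_funM; last exact: design_inner_obs_measurable.
    by apply: measurable_funM; first exact: measurable_cst.
  apply: measurable_funM; last exact: measurable_cst.
  apply: measurable_funM; last exact: measurable_cst.
  by apply: measurable_funM; [exact: measurable_cst|exact: measurable_funX].
- move=> i; rewrite expR0 (@gaussian_noise_mgf _ _ _ P)//.
    exact: (design_inner_gaussian model).
  by move=> S S' mS mS'; exact: (noise_design_independent model).
Qed.

Lemma noise_moment_tail (q g a : R) :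
  (\int[P]_w (`|xi0 w| `^ q)%:E = g%:E)%E -> 0 < a ->
  (P [set w | (a <= \sum_i `|xi i w| `^ q)%R] <= (n%:R * g / a)%:E)%E.
Proof.
move=> xig a0; have [_ _ _ _ _ noise _] := model.
have mq : measurable_fun setT (fun x : R => (`|x| `^ q)%:E).
  by apply/measurable_EFinP; apply: (measurableT_comp (measurable_powR q)).
have xiE i : (\int[P]_w (`|xi i w| `^ q)%:E = g%:E)%E.
  rewrite -xig.
  transitivity (\int[distribution P (xi i)]_x (`|x| `^ q)%:E)%E.
    by rewrite ge0_integral_distribution// => x; rewrite lee_fin powR_ge0.
  transitivity (\int[distribution P xi0]_x (`|x| `^ q)%:E)%E.
    by apply: eq_measure_integral => A mA _; exact: noise.
  by rewrite ge0_integral_distribution// => x; rewrite lee_fin powR_ge0.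
have mxi i : measurable_fun setT (fun w => `|xi i w| `^ q).
  by apply: (measurableT_comp (measurable_powR q)); exact: measurableT_comp.
have mS : measurable_fun setT (fun w => \sum_i `|xi i w| `^ q).
  exact: measurable_sum.
have S0 w : 0 <= \sum_i `|xi i w| `^ q.
  by apply: sumr_ge0 => i _; exact: powR_ge0.
have := ge0_markov P mS S0 (ltW a0).
under [in leRHS]eq_integral do rewrite -sumEFin.
rewrite ge0_integral_sum//; last by move=> i; exact/measurable_EFinP.
under [in leRHS]eq_bigr do rewrite xiE.
rewrite sumEFin sumr_const card_ord -[(g *+ n)%R]mulr_natl.
have -> : ((n%:R * g / a)%:E = a^-1%:E * (n%:R * g)%:E)%E.
  by rewrite -EFinM mulrC.
by rewrite lee_pdivlMl.
Qed.

End tail_bounds.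

(** * The event of small deviations *)

(** Comparison of the l^2 and l^q norms, q <= 2: after division by [S] all
    the terms are at most 1, hence dominated by their powers of exponent
    [q]. *)
Lemma sum_le_of_powR (R : realType) (n : nat) (a : 'I_n -> R) (S q : R) :
  (forall i, 0 <= a i) -> 0 < S -> 0 < q <= 2 ->
  \sum_i a i `^ q < S `^ q -> \sum_i a i ^+ 2 <= S ^+ 2.
Proof.
move=> a0 S0 /andP[q0 q2] aS.
pose b i := a i / S; have b0 i : 0 <= b i by rewrite divr_ge0// ltW.
have aE i : a i = S * b i by rewrite /b; field; rewrite gt_eqF.
have Sq0 : 0 < S `^ q by rewrite powR_gt0.
have bS : \sum_i b i `^ q < 1.
  rewrite -(ltr_pM2l Sq0) mulr1 big_distrr/=; apply: le_lt_trans aS.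
  by apply: ler_sum => i _; rewrite [in leRHS]aE powRM// ltW.
have b1 i : b i <= 1.
  rewrite leNgt; apply/negP => b1.
  have : 1 <= b i `^ q by rewrite -(powRr0 (b i)) ler_powR// ltW.
  have : b i `^ q <= \sum_i b i `^ q.
    by rewrite (bigD1 i)//= lerDl sumr_ge0// => j _; exact: powR_ge0.
  by move: bS; lra.
have le2 i : b i ^+ 2 <= b i `^ q.
  have [->|bi] := eqVneq (b i) 0; first by rewrite expr0n powR_ge0.
  by rewrite -powR_mulrn// ger_powR// b1 lt_def bi b0.
under eq_bigr do rewrite aE exprMn.
rewrite -big_distrr/= ler_piMr ?sqr_ge0//.
by apply: le_trans (ltW bS); apply: ler_sum => i _.
Qed.

Section good_event.
Context d (T : measurableType d) (R : realType) (P : probability T R).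
Variables (n d1 d2 : nat) (M : 'M[R]_(d1, d2)).
Variables (X : 'I_n -> 'I_d1 -> 'I_d2 -> {RV P >-> R}).
Variables (xi Y : 'I_n -> {RV P >-> R}) (xi0 : {RV P >-> R}).
Hypothesis model : trace_regression M X xi Y xi0.

Let obs_mean w := n%:R^-1 *: \sum_(i < n) Y i w *: design X i w.

(** The form of [A - M] splits into a centered signal part and a noise part. *)
Lemma form_decomposition (L : R) (u : 'rV[R]_d1) (v : 'rV[R]_d2) w :
  (0 < n)%N -> L != 0 ->
  mxform (obs_mean w - M) u v = n%:R^-1 *
    (L * \sum_i (mxinner (design X i w) (u^T *m v) *
        (mxinner (design X i w) M / L) - mxform M u v / L) +
     \sum_i xi i w * mxinner (design X i w) (u^T *m v)).
Proof.
move=> n0 L0; rewrite !mxform_inner mxinnerBl mxinnerZl mxinner_suml.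
set B := u^T *m v.
have -> : L * \sum_i (mxinner (design X i w) B *
      (mxinner (design X i w) M / L) - mxinner M B / L) =
    \sum_i (mxinner (design X i w) B * mxinner (design X i w) M) -
    n%:R * mxinner M B.
  rewrite sumrB sumr_const card_ord -mulr_natl mulrBr big_distrr/=.
  congr (_ - _); last by field.
  by apply: eq_bigr => i _; field.
have -> : \sum_(i < n) mxinner (Y i w *: design X i w) B =
    \sum_i (mxinner (design X i w) B * mxinner (design X i w) M) +
    \sum_i xi i w * mxinner (design X i w) B.
  rewrite -big_split/=; apply: eq_bigr => i _.
  by rewrite mxinnerZl (tr_model model); ring.
by field; rewrite pnatr_eq0 -lt0n.
Qed.

(** The event on which [A - M] is small at all the pairs of net points:
    [tau] is the level for the signal, [t2] the level for the noise, [S] the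
    bound on the l^2 norm of the noise vector, and [delta] bounds the
    probability that this bound fails. There are at most [expR (36 d1)] pairs,
    each of which fails with probability at most [2 expR (- 37 d1)]. *)
Lemma good_event (L tau t2 S q g delta : R) :
  (d2 <= d1)%N -> (0 < n)%N -> 0 < L -> mxinner M M = L ^+ 2 ->
  0 < tau <= 182 -> 0 < t2 -> 0 < S -> 0 < q <= 2 ->
  (\int[P]_w (`|xi0 w| `^ q)%:E = g%:E)%E ->
  37 * d1%:R <= n%:R * tau ^+ 2 / 5824 ->
  37 * d1%:R <= (n%:R * t2) ^+ 2 / (2 * S ^+ 2) ->
  n%:R * g / S `^ q <= delta ->
  exists E : set T, [/\ measurable E,
    ((1 - 2 * expR (- d1%:R) - delta)%:E <= P E)%E &
    forall w, E w -> forall f h, f \in net d1 -> h \in net d2 ->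
      mxform (obs_mean w - M) (net_point R f) (net_point R h) <= L * tau + t2].
Proof.
move=> d21 n0 L0 ML tau0 t20 S0 q0 xig hs hn hm.
(* The minimizer of lam^2 S^2 / 2 - lam n t2. *)
pose lam := n%:R * t2 / S ^+ 2.
pose U (p : net_index d1 * net_index d2) := net_point R p.1.
pose V (p : net_index d1 * net_index d2) := net_point R p.2.
pose B p := (U p)^T *m V p.
pose sig p w := \sum_i (mxinner (design X i w) (B p) *
        (mxinner (design X i w) M / L) - mxform M (U p) (V p) / L).
pose noi p w := \sum_i (lam * xi i w * mxinner (design X i w) (B p) -
        lam ^+ 2 * xi i w ^+ 2 * mxinner (B p) (B p) / 2).
pose mom w := \sum_i `|xi i w| `^ q.
pose E1 p := [set w | n%:R * tau <= sig p w].
pose E2 p := [set w | 37 * d1%:R <= noi p w].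
pose E3 := [set w | S `^ q <= mom w].
have mdes i A := measurable_design_inner X i A.
have mE1 p : measurable (E1 p).
  apply: measurable_superlevel; apply: measurable_sum => i.
  by apply: measurable_funB => //; apply: measurable_funM => //; apply: measurable_funM.
have mE2 p : measurable (E2 p).
  apply: measurable_superlevel; apply: measurable_sum => i.
  apply: measurable_funB.
    by apply: measurable_funM => //; exact: measurable_funM.
  apply: measurable_funM => //; apply: measurable_funM => //.
  by apply: measurable_funM => //; exact: measurable_funX.
have mE3 : measurable E3.
  apply: measurable_superlevel; apply: measurable_sum => i.
  by apply: (measurableT_comp (measurable_powR q)); exact: measurableT_comp.
pose s := enum (finset.setX (net d1) (net d2)).
have sP p : p \in s -> p.1 \in net d1 /\ p.2 \in net d2.
  by rewrite mem_enum inE => /andP.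
have Sq0 : 0 < S `^ q by rewrite powR_gt0.
have PE1 p : p \in s -> (P (E1 p) <= (expR (- (37 * d1%:R)))%:E)%E.
  move=> /sP[p1 p2]; apply: le_trans (signal_tail model L0 ML
    (net_point_le1 R p1) (net_point_le1 R p2) tau0) _.
  by rewrite lee_fin ler_expR lerN2.
have PE2 p : (P (E2 p) <= (expR (- (37 * d1%:R)))%:E)%E.
  exact: (noise_tail model).
have PE3 : (P E3 <= delta%:E)%E.
  by apply: le_trans (noise_moment_tail model xig Sq0) _; rewrite lee_fin.
pose bad := (\big[setU/set0]_(p <- s) (E1 p `|` E2 p)) `|` E3.
have mU : measurable (\big[setU/set0]_(p <- s) (E1 p `|` E2 p)).
  by apply: bigsetU_measurable => p _; exact: measurableU.
have mbad : measurable bad by exact: measurableU.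
have cards : (size s)%:R <= expR (36 * d1%:R) :> R.
  rewrite -cardE finset.cardsX natrM.
  apply: (@le_trans _ _ (expR (18 * d1%:R) * expR (18 * d2%:R))).
    by apply: ler_pM; rewrite ?ler0n// net_card.
  rewrite -expRD ler_expR.
  have : d2%:R <= d1%:R :> R by rewrite ler_nat.
  lra.
have Pbad : (P bad <= (2 * expR (- d1%:R) + delta)%:E)%E.
  apply: le_trans (measureU2 _ mU mE3) _; rewrite EFinD; apply: leeD => //.
  apply: le_trans (measure_bigsetU_le (b := 2 * expR (- (37 * d1%:R))) _ _) _.
  - by move=> p; exact: measurableU.
  - move=> p ps; apply: le_trans (measureU2 _ (mE1 p) (mE2 p)) _.
    have -> : 2 * expR (- (37 * d1%:R)) =
      expR (- (37 * d1%:R)) + expR (- (37 * d1%:R)) :> R by ring.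
    by rewrite EFinD; apply: leeD; [exact: PE1|exact: PE2].
  rewrite lee_fin mulrCA ler_pM2l//.
  apply: le_trans (ler_wpM2r (expR_ge0 _) cards) _.
  by rewrite -expRD ler_expR; lra.
exists (~` bad); split; first exact: measurableC.
  rewrite probability_setC//.
  have Pfin : P bad \is a fin_num by exact: fin_num_measure.
  rewrite -(fineK Pfin) -EFinB lee_fin.
  by move: Pbad; rewrite -(fineK Pfin) lee_fin; lra.
move=> w nbad f h fN hN; pose p := (f, h).
have ps : p \in s by rewrite mem_enum inE fN hN.
have nE3 : ~ E3 w by move=> e3; apply: nbad; right.
have nE12 : ~ (E1 p `|` E2 p) w.
  by move=> e; apply: nbad; left; rewrite -bigcup_seq; exists p.
have h1 : sig p w < n%:R * tau.
  by rewrite ltNge; apply/negP => e; apply: nE12; left.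
have h2 : noi p w < 37 * d1%:R.
  by rewrite ltNge; apply/negP => e; apply: nE12; right.
have h3 : mom w < S `^ q by rewrite ltNge; apply/negP.
have xi2 : \sum_i xi i w ^+ 2 <= S ^+ 2.
  have := @sum_le_of_powR R n (fun i => `|xi i w|) S q (fun=> normr_ge0 _) S0 q0 h3.
  by under eq_bigr do rewrite real_normK ?num_real//.
have n0' : 0 < n%:R :> R by rewrite ltr0n.
have lam0 : 0 < lam by rewrite divr_gt0 ?exprn_gt0// mulr_gt0.
have B1 : mxinner (B p) (B p) <= 1.
  rewrite mxinner_outer -[leRHS]mul1r.
  by apply: ler_pM; rewrite ?sqnorm_ge0//; exact: net_point_le1.
have B0 : 0 <= mxinner (B p) (B p) := mxinner_ge0 _.
have h4 : \sum_i xi i w * mxinner (design X i w) (B p) < n%:R * t2.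
  rewrite ltNge; apply/negP => e.
  have noiE : noi p w = lam * (\sum_i xi i w * mxinner (design X i w) (B p)) -
      lam ^+ 2 / 2 * (mxinner (B p) (B p) * \sum_i xi i w ^+ 2).
    rewrite /noi sumrB; congr (_ - _); rewrite !big_distrr/=.
      by apply: eq_bigr => i _; ring.
    by apply: eq_bigr => i _; ring.
  have e1 : mxinner (B p) (B p) * \sum_i xi i w ^+ 2 <= S ^+ 2.
    rewrite -[leRHS]mul1r; apply: ler_pM => //.
    by apply: sumr_ge0 => i _; exact: sqr_ge0.
  have e2 : lam ^+ 2 / 2 * (mxinner (B p) (B p) * \sum_i xi i w ^+ 2) <=
      lam ^+ 2 / 2 * S ^+ 2.
    by apply: ler_wpM2l => //; rewrite divr_ge0// sqr_ge0.
  have e3 : lam * (n%:R * t2) <=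
      lam * (\sum_i xi i w * mxinner (design X i w) (B p)).
    by rewrite ler_pM2l.
  have e4 : (n%:R * t2) ^+ 2 / (2 * S ^+ 2) =
      lam * (n%:R * t2) - lam ^+ 2 / 2 * S ^+ 2.
    by rewrite /lam; field; rewrite gt_eqF.
  move: h2; rewrite noiE; move: hn; rewrite e4; lra.
rewrite (form_decomposition (L := L))// ?gt_eqF//.
rewrite -/(sig p w).
have -> : L * tau + t2 = n%:R^-1 * (L * (n%:R * tau) + n%:R * t2).
  by field; rewrite gt_eqF.
rewrite ler_pM2l ?invr_gt0//; apply: lerD; last exact: ltW.
by rewrite ler_pM2l// ltW.
Qed.

End good_event.

(** * The sample size condition and the conclusion *)

(** The second term in the lower bound on the sample size [N], raised to the
    power [eps], makes the failure probability in [noise_moment_tail] of order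
    [1 / ln d1], with a constant free of [eps] because [1 + eps <= 2]; here
    [D] stands for [d1 r] and the argument of the power is the bound [S] of
    [good_event]. *)
Lemma heavy_tail_budget (R : realType) (c sigma eps g N D lnd : R) :
  0 < c <= 1 -> 0 < sigma -> 0 < eps <= 1 -> 0 <= g -> 0 < N -> 0 < D ->
  0 < lnd ->
  D `^ ((1 + eps) / (2 * eps)) * sigma `^ (- ((1 + eps) / eps)) *
    (g * lnd) `^ eps^-1 <= N ->
  N * g / (N * (c * sigma / Num.sqrt (74 * D))) `^ (1 + eps) <=
    74 / c ^+ 2 / lnd.
Proof.
move=> /andP[c0 c1] s0 /andP[e0 e1] g0 N0 D0 l0; set q := 1 + eps => BN.
have eN : eps != 0 by rewrite gt_eqF.
pose sD := Num.sqrt D; have sD0 : 0 < sD by rewrite sqrtr_gt0.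
have s74 : 1 <= Num.sqrt 74 :> R.
  by rewrite -[leLHS]sqrtr1 ler_wsqrtr// ler1n.
have s740 : 0 < Num.sqrt 74 :> R by lra.
have [a aE] : exists a : R, a = c / Num.sqrt 74 by eexists.
have a0 : 0 < a by rewrite aE divr_gt0.
have a1 : a <= 1 by rewrite aE ler_pdivrMr// mul1r; lra.
have a2 : a ^+ 2 = c ^+ 2 / 74 by rewrite aE expr_div_n sqr_sqrtr// ler0n.
have gl0 : 0 <= g * lnd by rewrite mulr_ge0// ltW.
have NE : sD `^ q * sigma `^ (- q) * (g * lnd) <= N `^ eps.
  apply: le_trans (ge0_ler_powR (ltW e0) _ _ BN); rewrite ?nnegrE ?(ltW N0)//.
    rewrite !powRM ?powR_ge0 ?mulr_ge0 ?powR_ge0 ?(ltW l0)//.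
    rewrite -!powRrM mulVf// !powRr1 ?(ltW l0)//.
    rewrite (_ : q / (2 * eps) * eps = 2^-1 * q); last by field.
    rewrite (_ : - (q / eps) * eps = - q); last by field.
    by rewrite powRrM powR12_sqrt// ltW.
  by rewrite !mulr_ge0 ?powR_ge0.
have SE : N * (c * sigma / Num.sqrt (74 * D)) = N * (a * (sigma * sD^-1)).
  by rewrite sqrtrM ?ler0n// aE /sD invfM; ring.
have w0 : 0 < N * (a * (sigma * sD^-1)).
  by rewrite !mulr_gt0// invr_gt0.
rewrite SE ler_pdivrMr ?powR_gt0//.
have aq : a ^+ 2 <= a `^ q.
  by rewrite -powR_mulrn ?(ltW a0)// ger_powR ?a0// /q; lra.
rewrite !powRM ?invr_ge0 ?mulr_ge0 ?invr_ge0//; try exact: ltW.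
have -> : N `^ q = N * N `^ eps.
  rewrite /q powRD; last by rewrite (gt_eqF N0) implybT.
  by rewrite powRr1 ?(ltW N0).
have inv : sD `^ q * sD^-1 `^ q = 1.
  by rewrite -powRM ?invr_ge0 ?ltW// mulfV ?gt_eqF// powR1.
have invs : sigma `^ (- q) * sigma `^ q = 1.
  by rewrite powRN mulVf// gt_eqF// powR_gt0.
have key : g * lnd <= N `^ eps * (sigma `^ q * sD^-1 `^ q).
  have -> : g * lnd = (sD `^ q * sigma `^ (- q) * (g * lnd)) *
     (sigma `^ q * sD^-1 `^ q).
    rewrite (_ : _ * _ * _ * _ = (sD `^ q * sD^-1 `^ q) *
      (sigma `^ (- q) * sigma `^ q) * (g * lnd)); last by ring.
    by rewrite inv invs !mul1r.
  by rewrite ler_wpM2r// mulr_ge0 ?powR_ge0.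
have -> : 74 / c ^+ 2 = (a ^+ 2)^-1 by rewrite a2 invf_div.
set W := N `^ eps * (sigma `^ q * sD^-1 `^ q) in key *.
rewrite (_ : _ * (N * N `^ eps * _) =
   (a `^ q / a ^+ 2) * (N * (W / lnd))); last first.
  by rewrite /W; field; rewrite !gt_eqF.
have h1 : 1 <= a `^ q / a ^+ 2 by rewrite ler_pdivlMr ?exprn_gt0// mul1r.
have h2 : g <= W / lnd by rewrite ler_pdivlMr.
have h3 : 0 <= N * (W / lnd).
  by rewrite mulr_ge0 ?(ltW N0)//; apply: le_trans h2.
apply: (@le_trans _ _ (N * (W / lnd))); first by rewrite ler_pM2l.
by rewrite -[leLHS]mul1r ler_wpM2r.
Qed.

Lemma expR1_le4 (R : realType) : expR 1 <= 4 :> R.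
Proof.
have h : (1 / 2) ^+ 2 <= expR (- 1) :> R.
  have -> : expR (- 1) = expR (- (1 / 2)) ^+ 2 :> R.
    by rewrite expr2 -expRD; congr expR; field.
  by rewrite lerXn2r ?nnegrE ?expR_ge0//; have := expR_ge1Dx (- (1 / 2) : R); lra.
have : expR 1 * expR (- 1) = 1 :> R by rewrite -expRD subrr expR0.
have := expR_gt0 (1 : R); move: h; nra.
Qed.

Theorem theorem5 (R : realType) (c0 : R) (c0_gt0 : 0 < c0) :
  exists C c1 c2 c3 : R,
    [/\ 0 < C, 0 < c1, 0 < c2 & 0 < c3] /\
    forall (d : measure_display) (T : measurableType d) (P : probability T R)
      (n d1 d2 r : nat) (M : 'M[R]_(d1, d2))
      (X : 'I_n -> 'I_d1 -> 'I_d2 -> {RV P >-> R})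
      (xi Y : 'I_n -> {RV P >-> R}) (xi0 : {RV P >-> R})
      (eps gamma1 : R) (M0 : T -> 'M[R]_(d1, d2)),
    (d2 <= d1)%N -> (0 < r)%N -> \rank M = r ->
    trace_regression M X xi Y xi0 ->
    0 < eps <= 1 ->
    ('E_P[fun w => (`|xi0 w| `^ (1 + eps))%R] = gamma1%:E)%E ->
    (forall w, is_truncated_svd r
       (n%:R^-1 *: \sum_(i < n) Y i w *: design X i w) (M0 w)) ->
    let sigma_r := singular_value M r in
    let kappa := singular_value M 1 / sigma_r in
    n%:R > C * Num.max
      (kappa ^+ 2 * d1%:R * r%:R ^+ 2 * ln d1%:R)
      ((d1%:R * r%:R) `^ ((1 + eps) / (2 * eps)) *
       sigma_r `^ (- ((1 + eps) / eps)) *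
       (gamma1 * ln d1%:R) `^ eps^-1) ->
    exists E : set T,
      [/\ measurable E,
          (P E > (1 - c1 * d1%:R^-1 - c2 * (ln d1%:R)^-1
                  - c3 * expR (- d1%:R))%:E)%E &
          forall w, E w -> frobenius (M0 w - M) <= c0 * sigma_r].
Proof.
have [c cE] : exists c : R, c = Num.min 1 c0 / 12 by eexists.
have c_gt0 : 0 < c by rewrite cE divr_gt0// lt_min ltr01.
have c_le1 : c <= 1 by rewrite cE ler_pdivrMr// ge_min; apply/orP; left; lra.
have c_c0 : 12 * c <= c0 by rewrite cE mulrC divfK// ge_min lexx orbT.
have [N NE] : exists N : R, N = 5824%:R by exists 5824%:R.
have N0 : 0 < N by rewrite NE ltr0n.
have N1 : 1 <= N by rewrite NE ler1n.
pose C := N * 37 / c ^+ 2.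
have c2_gt0 : 0 < c ^+ 2 by rewrite exprn_gt0.
have c2_le1 : c ^+ 2 <= 1 by rewrite expr_le1// ltW.
have C_ge1 : 1 <= C by rewrite ler_pdivlMr// mul1r; lra.
pose K := 74 / c ^+ 2; have K0 : 0 < K by rewrite divr_gt0.
(* With c1 = 4 the claim is trivial for d1 < 4, so that ln d1 >= 1 below. *)
exists C, 4, (K + 1), 3; split; first by split => //; lra.
move=> d T P n d1 d2 r M X xi Y xi0 eps gamma1 M0 d21 r0 rM model eps01 xig M0E sr
  kappa nC.
have q02 : 0 < 1 + eps <= 2.
  have /andP[e0 e1] := eps01.
  by rewrite addr_gt0//= -[leRHS]/(1 + 1) lerD2l.
have xig' : (\int[P]_w (`|xi0 w| `^ (1 + eps))%:E = gamma1%:E)%E.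
  by rewrite -xig unlock.
have [U [V svdM]] := singular_valueP M.
have [_ _ [s_ge0 s_dec _] _] := svdM.
have sr0 : 0 < sr by rewrite /sr -rM singular_value_gt0// rM.
have s1r : sr <= singular_value M 1.
  by rewrite /sr -{1}(prednK r0); exact: s_dec.
have kappa1 : 1 <= kappa by rewrite ler_pdivlMr// mul1r.
have d1r : (r <= d1)%N by rewrite -rM rank_leq_row.
have d1_gt0 : (0 < d1)%N by exact: leq_trans r0 d1r.
have d1R : 0 < d1%:R :> R by rewrite ltr0n.
have ed0 : 0 < expR (- d1%:R) :> R := expR_gt0 _.
have [d1_4|d1_4] := ltP (d1%:R : R) 4.
  exists set0; split => //; rewrite measure0 lte_fin.
  have h1 : 1 < 4 * d1%:R^-1 :> R by rewrite ltr_pdivlMr// mul1r.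
  have h2 : 0 <= (K + 1) * (ln d1%:R)^-1.
    by rewrite mulr_ge0 ?invr_ge0 ?ln_ge0 ?ler1n//; lra.
  lra.
have ln1 : 1 <= ln d1%:R :> R.
  by rewrite -[leLHS]expRK ler_ln ?posrE ?expR_gt0//; exact: le_trans (expR1_le4 R) d1_4.
have ln0 : 0 < ln d1%:R :> R := lt_le_trans ltr01 ln1.
set m1 := kappa ^+ 2 * d1%:R * r%:R ^+ 2 * ln d1%:R in nC.
set m2 := _ * _ * _ in nC.
have r1 : 1 <= r%:R :> R by rewrite ler1n.
have rR : 0 < r%:R :> R by rewrite ltr0n.
have kappa0 : 0 < kappa := lt_le_trans ltr01 kappa1.
have m2_ge0 : 0 <= m2 by rewrite !mulr_ge0// powR_ge0.
have C0 : 0 < C := lt_le_trans ltr01 C_ge1.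
have n1 : C * m1 < n%:R.
  by apply: le_lt_trans nC; rewrite ler_pM2l// le_max lexx.
have n2 : m2 < n%:R.
  apply: le_lt_trans nC; apply: (@le_trans _ _ (C * m2)).
    by rewrite ler_peMl.
  by rewrite ler_pM2l// le_max lexx orbT.
have nR : 0 < n%:R :> R by exact: le_lt_trans n2.
have n_gt0 : (0 < n)%N by rewrite -(ltr0n R).
have g_ge0 : 0 <= gamma1.
  by rewrite -lee_fin -xig; apply: expectation_ge0 => w; exact: powR_ge0.
have MM_le : mxinner M M <= r%:R * singular_value M 1 ^+ 2.
  by have := frobenius_sqr_le svdM; rewrite rM.
have MM_gt0 : 0 < mxinner M M.
  rewrite lt_def mxinner_ge0 andbT; apply: contraTneq r0 => MM0.
  rewrite -rM -eqn0Ngt mxrank_eq0; apply/eqP/matrixP => i j; rewrite mxE.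
  move/eqP: MM0; rewrite mxinnerE pair_big/= psumr_eq0; last first.
    by move=> k _; rewrite -expr2 sqr_ge0.
  move=> /allP /(_ (i, j) (mem_index_enum _))/=.
  by rewrite mulf_eq0 orbb => /eqP.
pose L := Num.sqrt (mxinner M M).
have L0 : 0 < L by rewrite sqrtr_gt0.
have L2 : mxinner M M = L ^+ 2 by rewrite sqr_sqrtr// ltW.
pose sqr := Num.sqrt (r%:R : R).
have sqr0 : 0 < sqr by rewrite sqrtr_gt0.
have sqr2 : sqr ^+ 2 = r%:R by rewrite sqr_sqrtr// ltW.
have L_le : L <= sqr * singular_value M 1.
  rewrite -(@ler_pXn2r _ 2)// ?nnegrE ?(ltW L0)//.
    by rewrite exprMn sqr2 -L2.
  by rewrite mulr_ge0// ltW.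
(* Both levels contribute the same amount t2 = c sigma_r / sqrt r, since
   L <= sqrt r sigma_1. *)
pose tau := c / (kappa * r%:R).
have kr1 : 1 <= kappa * r%:R by rewrite mulr_ege1.
have kr0 : 0 < kappa * r%:R := lt_le_trans ltr01 kr1.
have tau0 : 0 < tau by rewrite divr_gt0.
have tau1 : tau <= 182.
  apply: (@le_trans _ _ 1); last by rewrite ler1n.
  by rewrite ler_pdivrMr// mul1r (le_trans c_le1).
pose t2 := c * sr / sqr.
have t20 : 0 < t2 by rewrite divr_gt0// mulr_gt0.
(* Chosen so that the condition on S in good_event is an equality. *)
pose S := n%:R * (c * sr / Num.sqrt (74 * (d1%:R * r%:R))).
have dr0 : 0 < d1%:R * r%:R :> R by rewrite mulr_gt0.
have s74dr : 0 < Num.sqrt (74 * (d1%:R * r%:R)) :> R.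
  by rewrite sqrtr_gt0 mulr_gt0.
have S0 : 0 < S by rewrite mulr_gt0// divr_gt0// mulr_gt0.
have hs : 37 * d1%:R <= n%:R * tau ^+ 2 / 5824.
  have -> : 5824 = N by rewrite NE.
  rewrite ler_pdivlMr// expr_div_n mulrA ler_pdivlMr ?exprn_gt0//.
  have : C * m1 * c ^+ 2 <= n%:R * c ^+ 2 by rewrite ler_wpM2r ?ltW.
  apply: le_trans.
  have -> : C * m1 * c ^+ 2 =
    37 * d1%:R * N * (kappa * r%:R) ^+ 2 * ln d1%:R.
    by rewrite /C /m1; field; rewrite gt_eqF.
  rewrite ler_peMr//; apply: mulr_ge0; last exact: sqr_ge0.
  by rewrite !mulr_ge0// ltW.
have hn : 37 * d1%:R <= (n%:R * t2) ^+ 2 / (2 * S ^+ 2).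
  rewrite le_eqVlt; apply/orP; left; apply/eqP.
  rewrite /S /t2 !exprMn !exprVn sqr2 sqr_sqrtr; last by rewrite mulr_ge0// ltW.
  by field; rewrite !gt_eqF.
have hm : n%:R * gamma1 / S `^ (1 + eps) <= K / ln d1%:R.
  by apply: heavy_tail_budget => //; [rewrite c_gt0|exact: ltW].
have tau182 : 0 < tau <= 182 by rewrite tau0.
have [E [mE PE EP]] := good_event model d21 n_gt0 L0 L2 tau182 t20 S0 q02 xig'
  hs hn hm.
exists E; split => //.
  apply: lt_le_trans PE; rewrite lte_fin.
  have h1 : 0 < 4 * d1%:R^-1 :> R by rewrite mulr_gt0// invr_gt0.
  have h2 : 0 < (ln d1%:R)^-1 :> R by rewrite invr_gt0.
  by rewrite mulrDl mul1r; clear -h1 h2 ed0; lra.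
move=> w Ew.
have [s [U' [V' svdD]]] :=
  svd_exists (n%:R^-1 *: \sum_(i < n) Y i w *: design X i w - M).
have s0b := svd_net_le svdD (EP w Ew).
have [_ _ [s0 _ _] _] := svdD.
have Ltau : L * tau <= t2.
  apply: le_trans (ler_wpM2r (ltW tau0) L_le) _.
  rewrite le_eqVlt; apply/orP; left; apply/eqP.
  have s1_gt0 := lt_le_trans sr0 s1r.
  by rewrite /tau /t2 /kappa -sqr2; field; rewrite !gt_eqF.
have s04 : s 0%N <= 4 * t2 by clear -s0b Ltau; lra.
have := truncated_svd_error (M0E w) svdD; rewrite rM => /(_ (leqnn _)) err.
rewrite /frobenius.
have -> : c0 * sr = Num.sqrt ((c0 * sr) ^+ 2).
  by rewrite sqrtr_sqr gtr0_norm// mulr_gt0.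
apply: ler_wsqrtr; apply: le_trans err _.
apply: (@le_trans _ _ (8 * r%:R * (4 * t2) ^+ 2)).
  apply: ler_wpM2l; first by rewrite mulr_ge0// ltW.
  by apply: lerXn2r; rewrite ?nnegrE// ltW// mulr_gt0.
have -> : 8 * r%:R * (4 * t2) ^+ 2 = 128 * (c * sr) ^+ 2.
  by rewrite /t2 -sqr2; field; rewrite gt_eqF.
apply: (@le_trans _ _ ((12 * c * sr) ^+ 2)).
  have -> : (12 * c * sr) ^+ 2 = 144 * (c * sr) ^+ 2 by ring.
  by rewrite ler_wpM2r ?sqr_ge0// ler_nat.
by apply: lerXn2r; rewrite ?ler_pM2r// nnegrE ltW// !mulr_gt0.
Qed.
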